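(* For every $\delta>0$ there exists $n_0\in\mathbb{N}$ such that the following holds for all integers $n\ge n_0$ divisible by $3$. Let $\mathscr{F}=\{F_1,\dots,F_{n/3}\}$ be a family of $3$-uniform hypergraphs, all on the same vertex set of size $n$, such that no $F_i$ has an isolated vertex. If $\sigma_2(F_i)>\left(\frac{2}{3}+\delta\right)n^2$ for every $i\in[n/3]$, then $\mathscr{F}$ admits a rainbow matching.
   Context: A $3$-uniform hypergraph ($3$-graph) $F$ is a pair $(V,E)$ with $E$ a family of $3$-element subsets of $V$. For $v\in V$, $\deg_F(v)$ is the number of edges containing $v$; $v$ is isolated if $\deg_F(v)=0$. Two distinct vertices are adjacent in $F$ if some edge of $F$ contains both. $\sigma_2(F)=\min\{\deg_F(u)+\deg_F(v): u,v\in V(F)\text{ adjacent in }F\}$. A rainbow matching for $\{F_1,\dots,F_t\}$ is a set of $t$ pairwise disjoint edges $e_1,\dots,e_t$ with $e_i\in E(F_i)$ for each $i$. *)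

(* Defs.v *)
From HB Require Import structures.
From mathcomp Require Import all_boot all_order all_algebra.
From mathcomp Require Import reals.

Set Implicit Arguments.
Unset Strict Implicit.
Unset Printing Implicit Defensive.

(* The vertex set is the whole finite type T. *)
Record hypergraph3 (T : finType) := Hypergraph3 {
  edges : {set {set T}};
  edges_uniform : forall e, e \in edges -> #|e| = 3
}.

Definition deg (T : finType) (F : hypergraph3 T) (v : T) : nat :=
  #|[set e in edges F | v \in e]|.

Definition isolated (T : finType) (F : hypergraph3 T) (v : T) : bool :=
  deg F v == 0.

Definition adjacent (T : finType) (F : hypergraph3 T) (u v : T) : bool :=
  (u != v) && [exists e in edges F, (u \in e) && (v \in e)].

(* The initial value 2 * #|edges F| is an upper bound for every
   deg F u + deg F v, so it does not affect the minimum when some pair is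
   adjacent; if no pair is adjacent, then F has no edges and sigma2 F = 0. *)
Definition sigma2 (T : finType) (F : hypergraph3 T) : nat :=
  \big[minn/2 * #|edges F|]_(p : T * T | adjacent F p.1 p.2)
    (deg F p.1 + deg F p.2).

(* The family is indexed, so the F i need not be distinct. *)
Definition rainbow_matching (T : finType) (t : nat)
    (F : 'I_t -> hypergraph3 T) (e : 'I_t -> {set T}) : Prop :=
  (forall i, e i \in edges (F i)) /\
  (forall i j, i != j -> [disjoint e i & e j]).

(* Main.v *)
(* Idea: absorption, with every random choice derandomised.

   (1) Dual step.  If all the links in S have the right density, then for every
   weight y on S some edge e inside S has y(e) <= 3 * average(y).  This is the LP
   dual of the existence of a perfect fractional matching.  It is proved by
   summing y(a) + y(b) over all pairs, looking only at the link of a vertex of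
   least weight and at the link of its lightest neighbour.

   (2) Almost perfect matching.  Colours are treated one after the other.  The
   edge removed for a colour is given by (1), for the gradient y of an
   exponential potential that penalises every pair (colour, vertex) whose link
   density in the remaining set has dropped; so all the densities, and hence the
   hypothesis of (1), survive until only a small linear number of colours is left.

   (3) Absorbers.  For a colour c and vertices x1, x2, x3, an absorber consists of
   three disjoint coloured edges {y_i, a_i, b_i} such that each {x_i, a_i, b_i}
   has the same colour as {y_i, a_i, b_i} and {y1, y2, y3} has colour c.  Adjacent
   vertices have at least n^2/3 ordered pairs in common in their links.  Each x_i
   is often adjacent to at least n/sqrt(3) vertices y_i, which leaves n^2/3 pairs
   (y2, y3), and the link of a typical y1 has more than 2n^2/3 ordered pairs; as
   1/3 + 2/3 = 1, a positive proportion of all candidates are absorbers.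
   Multiplicative weights then select a linear family of disjoint absorbers that
   meets every (c, x1, x2, x3) linearly often, and the leftover of (2) is
   absorbed greedily. *)

Require Import Defs.
From mathcomp Require Import all_boot all_order all_algebra.
From mathcomp Require Import reals sequences exp.
From mathcomp Require Import ring lra zify.
Import Order.TTheory GRing.Theory Num.Theory.
Set Implicit Arguments.
Unset Strict Implicit.
Unset Printing Implicit Defensive.
Local Open Scope ring_scope.

(** * Links and the light edge *)

Definition uniform3 (T : finType) (E : {set {set T}}) : Prop :=
  forall e, e \in E -> #|e| = 3.

(* Links consist of ordered pairs, so their cardinal is twice the degree. *)
Definition link (T : finType) (E : {set {set T}}) (S : {set T}) (v : T) :
    {set T * T} :=
  [set p in setX S S | [set v; p.1; p.2] \in E].

Lemma set3C (T : finType) (a b c : T) : [set a; b; c] = [set b; a; c].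
Proof. by rewrite (setUC [set a]). Qed.

Lemma set3CA (T : finType) (a b c : T) : [set a; b; c] = [set a; c; b].
Proof. by rewrite -!setUA (setUC [set b]). Qed.

Lemma mem_link (T : finType) (E : {set {set T}}) (S : {set T}) (v a b : T) :
  ((a, b) \in link E S v) = [&& a \in S, b \in S & [set v; a; b] \in E].
Proof. by rewrite !inE /= andbA. Qed.

Lemma mem_linkC (T : finType) (E : {set {set T}}) (S : {set T}) (v a b : T) :
  ((a, b) \in link E S v) = ((b, a) \in link E S v).
Proof. by rewrite !mem_link set3CA andbCA. Qed.

Lemma link_sub (T : finType) (E : {set {set T}}) (S : {set T}) (v : T) :
  link E S v \subset setX S S.
Proof. by apply/subsetP => p; rewrite inE => /andP[]. Qed.

Lemma card_link_le (T : finType) (E : {set {set T}}) (S : {set T}) (v : T) :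
  (#|link E S v| <= #|S| ^ 2)%N.
Proof. by rewrite -mulnn -cardsX subset_leq_card // link_sub. Qed.

(** The sum is split over [A], [B :\: A] and [U :\: B]. In [light_edge] the total is zero, so a
    positive lower bound of this shape is a contradiction. *)
Lemma sum_ge_three_levels (K : realFieldType) (I : finType) (A B U : {set I})
    (f : I -> K) (al be ze : K) :
  A \subset B -> B \subset U ->
  {in A, forall i, al <= f i} -> {in B, forall i, be <= f i} ->
  {in U, forall i, ze <= f i} ->
  al * #|A|%:R + be * (#|B|%:R - #|A|%:R) + ze * (#|U|%:R - #|B|%:R)
    <= \sum_(i in U) f i.
Proof.
move=> AB BU fA fB fU.
have sU (X : {set I}) : X \subset U ->
    #|X|%:R = \sum_(i in U) (i \in X)%:R :> K.
  move=> XU; rewrite -sum1_card natr_sum [RHS](bigID (mem X)) /=.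
  rewrite [X in _ + X]big1 ?addr0; last by move=> i /andP[_ /negPf ->].
  apply: eq_big => [i|i ->//].
  by apply/idP/andP => [iX|[]//]; split=> //; apply: (subsetP XU).
rewrite (sU A) ?(subset_trans AB) // (sU B) // (sU U) //.
rewrite -!sumrB !mulr_sumr -!big_split /=; apply: ler_sum => i iU.
rewrite iU; case: (boolP (i \in A)) => iA.
  by rewrite (subsetP AB _ iA) /= ?subrr !mulr0 mulr1 !addr0 fA.
case: (boolP (i \in B)) => iB /=.
  by rewrite subrr subr0 !mulr0 mulr1 add0r addr0 fB.
by rewrite subrr subr0 !mulr0 mulr1 !add0r fU.
Qed.

(** By contradiction: the weight is centred to [z], all edges inside [S] are assumed positive, and
    the sum of [z a + z b] over [S * S], which is zero, is shown to be positive. This uses only the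
    link [L1] of a lightest vertex [v1] and the link [L2] of its lightest neighbour [u]. *)
Lemma light_edge (K : realFieldType) (T : finType) (E : {set {set T}})
    (S : {set T}) (y : T -> K) :
  S != set0 ->
  {in S, forall v, link E S v != set0} ->
  (forall u v w, u \in S -> v \in S -> w \in S -> [set u; v; w] \in E ->
    (4 * #|S| ^ 2 < 3 * (#|link E S u| + #|link E S v|))%N) ->
  exists a b d, [/\ a \in S, b \in S, d \in S, [set a; b; d] \in E &
    y a + y b + y d <= 3 / #|S|%:R * \sum_(v in S) y v].
Proof.
move=> /set0Pn[x0 x0S] link0 ore.
have r0 : 0 < #|S|%:R :> K by rewrite ltr0n; apply/card_gt0P; exists x0.
set r : K := #|S|%:R in r0 *.
pose mu := (\sum_(v in S) y v) / r.
pose z v := y v - mu.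
have sz : \sum_(v in S) z v = 0.
  rewrite sumrB sumr_const -mulr_natl -/r /mu mulrC divfK ?subrr //.
  by rewrite lt0r_neq0.
pose bad := [exists a in S, exists b in S, exists d in S,
  ([set a; b; d] \in E) && (z a + z b + z d <= 0)].
case: (boolP bad) => [|nbad].
  case/existsP => a /andP[aS /existsP[b /andP[bS /existsP[d /andP[dS]]]]].
  case/andP => abd le0; exists a, b, d; split => //.
  move: le0; rewrite /z mulrAC -mulrA -/mu; lra.
have heavy a b d : a \in S -> b \in S -> d \in S -> [set a; b; d] \in E ->
    0 < z a + z b + z d.
  move=> aS bS dS abd; rewrite ltNge; apply: contra nbad => le0.
  apply/existsP; exists a; rewrite aS /=; apply/existsP; exists b.
  by rewrite bS /=; apply/existsP; exists d; rewrite dS abd.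
pose v1 := [arg min_(v < x0 in S) z v]%O.
have [v1S minv1] : v1 \in S /\ {in S, forall v, z v1 <= z v}.
  by rewrite /v1; case: arg_minP.
clearbody v1.
have /set0Pn[p1 p1L] := link0 _ v1S.
set L1 := link E S v1 in p1L.
pose nb := [pred a | [exists b, (a, b) \in L1]].
have nbp1 : nb p1.1 by apply/existsP; exists p1.2; rewrite -surjective_pairing.
pose u := [arg min_(a < p1.1 | nb a) z a]%O.
have [nbu minu] : nb u /\ forall a, nb a -> z u <= z a.
  by rewrite /u; case: arg_minP.
clearbody u.
have [w uwL] := existsP nbu.
move: (uwL); rewrite mem_link => /and3P[uS wS v1uw].
have degs := ore _ _ _ v1S uS wS v1uw.
set L2 := link E S u.
(* Positivity of the edges gives [f > m] on [L1] and [f > - q] on [L2]; minimality of [v1] gives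
   [f >= - 2 * m] everywhere. *)
pose m := - z v1; pose q := z u.
pose f (p : T * T) := z p.1 + z p.2.
have sf : \sum_(p in setX S S) f p = 0.
  have -> : \sum_(p in setX S S) f p = \sum_(a in S) \sum_(b in S) (z a + z b).
    rewrite pair_big_dep /=; apply: eq_bigl => p; by rewrite inE.
  under eq_bigr do rewrite big_split sumr_const /= sz addr0.
  by rewrite sumrMnl sz mul0rn.
pose p0 := [arg min_(p < p1 in L1) f p]%O.
have [p0L minp0] : p0 \in L1 /\ {in L1, forall p, f p0 <= f p}.
  by rewrite /p0; case: arg_minP.
clearbody p0.
have L1S p : p \in L1 -> [/\ p.1 \in S, p.2 \in S & [set v1; p.1; p.2] \in E].
  by rewrite (surjective_pairing p) mem_link => /and3P[].
have fp0 : m < f p0.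
  have [aS bS abE] := L1S _ p0L.
  by have := heavy _ _ _ v1S aS bS abE; rewrite /m /f; lra.
have L1u p : p \in L1 -> q <= z p.1 /\ q <= z p.2.
  case: p => a b abL; split; apply: minu; apply/existsP.
    by exists b.
  by exists a; rewrite mem_linkC.
have m0 : 0 <= m.
  rewrite leNgt; apply/negP => m0.
  suff : 0 < \sum_(v in S) z v by rewrite sz ltxx.
  rewrite (bigD1 v1) //=; apply: ltr_pwDl; first by move: m0; rewrite /m; lra.
  apply: sumr_ge0 => v /andP[vS _]; have := minv1 _ vS; move: m0.
  by rewrite /m; lra.
have qm : - m <= q by rewrite /m opprK; apply: minv1.
have fm p : p \in setX S S -> - (2 * m) <= f p.
  rewrite inE => /andP[aS bS]; have := minv1 _ aS; have := minv1 _ bS.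
  by rewrite /f /m; lra.
pose G := [set p in setX S S | - q < f p].
have GS : G \subset setX S S by apply/subsetP => p; rewrite inE => /andP[].
have fG p : p \in G -> - q <= f p by rewrite inE => /andP[_ /ltW].
have L2G : L2 \subset G.
  apply/subsetP => -[a b] abL; rewrite inE (subsetP (link_sub E S u) _ abL) /=.
  move: abL; rewrite mem_link => /and3P[aS bS abE].
  by have := heavy _ _ _ uS aS bS abE; rewrite /f /q /=; lra.
have L1G : L1 \subset G.
  apply/subsetP => p pL; rewrite inE (subsetP (link_sub E S v1) _ pL) /=.
  by have := minp0 _ pL; lra.
pose d1 : K := #|L1|%:R; pose d2 : K := #|L2|%:R; pose g : K := #|G|%:R.
have d12 : 4 / 3 * r ^+ 2 < d1 + d2.
  by move: degs; rewrite -mulnn -(ltr_nat K) !natrM natrD -/r -/d1 -/d2; lra.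
have d1g : d1 <= g by rewrite ler_nat subset_leq_card.
have d2g : d2 <= g by rewrite ler_nat subset_leq_card.
have d10 : 0 < d1 by rewrite ltr0n; apply/card_gt0P; exists p0.
have d2r : d2 <= r ^+ 2 by rewrite -natrX ler_nat card_link_le.
have cSS : #|setX S S|%:R = r ^+ 2 :> K by rewrite cardsX natrM expr2.
have [qm2|qm2] := leP q (m / 2).
  have := sum_ge_three_levels L1G GS minp0 fG fm; rewrite sf cSS -/d1 -/g => le0.
  (* [sum f >= m d1 - q (g - d1) - 2 m (r^2 - g)] with [g >= d1] and [g >= d2] *)
  have lt0 : m * d1 < f p0 * d1 by rewrite ltr_pM2r.
  have [d1b|d1b] := leP (2 / 3 * r ^+ 2) d1; nra.
(* Now [q > 0]. All neighbours of [v1] weigh at least [q], so [L1] lies in [Q * Q], where [f]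
   reaches [2 * q]. Moreover [d1 > r ^+ 2 / 3], because [d2 <= r ^+ 2]. *)
pose Q := [set v in S | q <= z v].
have QG : setX Q Q \subset G.
  apply/subsetP => p; rewrite !inE => /andP[/andP[-> qa] /andP[-> qb]] /=.
  by rewrite /f; lra.
have L1Q : L1 \subset setX Q Q.
  apply/subsetP => p pL; have [aS bS _] := L1S _ pL; have [qa qb] := L1u _ pL.
  by rewrite !inE aS bS qa qb.
have fQ p : p \in setX Q Q -> 2 * q <= f p.
  by rewrite !inE => /andP[/andP[_ qa] /andP[_ qb]]; rewrite /f; lra.
pose s2 : K := #|setX Q Q|%:R.
have d1s : d1 <= s2 by rewrite ler_nat subset_leq_card.
have s2g : s2 <= g by rewrite ler_nat subset_leq_card.
have [q2m|q2m] := leP q (2 * m).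
  have := sum_ge_three_levels QG GS fQ fG fm; rewrite sf cSS -/s2 -/g; nra.
(* Here [- q < - 2 * m], so the bottom level [- 2 * m] is the better bound on [G] too. *)
have := sum_ge_three_levels QG GS fQ (fun p pG => fm p (subsetP GS p pG)) fm.
rewrite sf cSS -/s2 -/g; nra.
Qed.

(** * Derandomised selection *)

Lemma exists_le_average (K : realFieldType) (A : finType) (S : {set A})
    (F : A -> K) (M : K) :
  S != set0 -> \sum_(a in S) F a <= #|S|%:R * M ->
  exists2 a, a \in S & F a <= M.
Proof.
move=> S0 le; apply/exists_inP; apply: contraT => /exists_inPn gtM.
move: le; rewrite leNgt mulr_natl -sumr_const ltr_sum //.
  by have /set0Pn[a aS] := S0; apply/hasP; exists a; rewrite ?mem_index_enum.
by move=> a aS; rewrite ltNge gtM.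
Qed.

Lemma card_bigcup_le (K : realFieldType) (I A : finType) (s : {set I})
    (B : I -> {set A}) (M : K) :
  (forall i, #|B i|%:R <= M) -> #|\bigcup_(i in s) B i|%:R <= #|s|%:R * M.
Proof.
move=> BM.
suff : #|\bigcup_(i in s) B i|%:R <= \sum_(i in s) M by rewrite sumr_const mulr_natl.
apply: (@big_rec2 _ _ (fun (X : {set A}) (y : K) => #|X|%:R <= y)).
  by rewrite cards0.
move=> a y X _ le; apply: le_trans (lerD (BM a) le); rewrite -natrD ler_nat.
by rewrite cardsU leq_subr.
Qed.

(* Derandomised independent sampling: [1/2 ^ hits] is the multiplicative weight
   of an element [q] that has been hit by the chosen sets. *)
Lemma select_absorbers (K : realFieldType) (A Q : finType)
    (good : Q -> {set A}) (confl : rel A) (ga ka : K) (k : nat) :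
  (0 < #|A|)%N -> (0 < #|Q|)%N -> 0 < ga -> reflexive confl ->
  symmetric confl ->
  (forall q, ga * #|A|%:R <= #|good q|%:R) ->
  (forall a, #|[set b | confl a b]|%:R <= ka * #|A|%:R) ->
  2 * k%:R * ka <= ga ->
  exists s : {set A}, [/\ #|s| = k, {in s, forall a, exists q, a \in good q},
    {in s &, forall a b, a != b -> ~~ confl a b} &
    \sum_q (1 / 2) ^+ #|s :&: good q| <= #|Q|%:R * (1 - ga / 4) ^+ k].
Proof.
move=> A0 Q0 ga0 cxx cC goodq conf.
have cA : 0 < #|A|%:R :> K by rewrite ltr0n.
have ka0 : 0 <= ka.
  have /card_gt0P[a _] := A0.
  by rewrite -(pmulr_lge0 _ cA); apply: le_trans (conf a).
elim: k => [_|k IH kle].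
  exists set0; split=> [|a|a b|]; rewrite ?cards0 ?inE //.
  under eq_bigr do rewrite set0I cards0 expr0.
  by rewrite sumr_const expr0 mulr1.
have [|s [sk sg sc sw]] := IH.
  apply: le_trans kle; apply: ler_wpM2r => //.
  by apply: ler_wpM2l => //; rewrite ler_nat.
(* The elements chosen so far exclude at most [k * ka * #|A|] candidates, hence at most half of each
   [good q]. *)
pose bad := \bigcup_(a in s) [set b | confl a b].
have cbad : #|bad|%:R <= ga / 2 * #|A|%:R.
  apply: le_trans (card_bigcup_le s conf) _; rewrite sk mulrA ler_pM2r //.
  by move: kle; rewrite -[k.+1]addn1 natrD; lra.
pose S := [set a | a \notin bad & [exists q, a \in good q]].
have cS q : ga / 2 * #|A|%:R <= #|S :&: good q|%:R.
  have : #|good q|%:R <= #|S :&: good q|%:R + #|bad|%:R :> K.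
    rewrite -natrD ler_nat; apply: (@leq_trans #|S :&: good q :|: bad|).
      apply: subset_leq_card; apply/subsetP => a aq; rewrite !inE aq andbT.
      have -> : [exists q0, a \in good q0] by apply/existsP; exists q.
      by rewrite andbT orNb.
    by rewrite cardsU leq_subr.
  by have := goodq q; move: cbad; lra.
have cS0 : S != set0.
  have /card_gt0P[q _] := Q0.
  rewrite -card_gt0 -(ltr_nat K); apply: (@lt_le_trans _ _ #|S :&: good q|%:R).
    by apply: lt_le_trans (cS q); rewrite mulr_gt0 ?divr_gt0.
  by rewrite ler_nat subset_leq_card // subsetIl.
pose w q : K := (1 / 2) ^+ #|s :&: good q|.
have w0 q : 0 <= w q by rewrite exprn_ge0 ?divr_ge0 ?ler0n.
(* Each [q] is hit by at least a [ga / 2] fraction of the candidates and a hit halves its weight, so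
   on average the total weight shrinks by a factor [1 - ga / 4]. *)
have hit : \sum_(a in S) \sum_q w q * (1 - (a \in good q)%:R / 2) <=
    #|S|%:R * ((1 - ga / 4) * \sum_q w q).
  rewrite exchange_big /= !mulr_sumr; apply: ler_sum => q _.
  rewrite -mulr_sumr sumrB sumr_const -mulr_suml.
  have -> : \sum_(a in S) (a \in good q)%:R = #|S :&: good q|%:R :> K.
    rewrite -sum1_card natr_sum (bigID (mem (good q))) /=.
    rewrite [X in _ + X]big1 ?addr0; last by move=> i /andP[_ /negPf ->].
    by apply: eq_big => [a|a /andP[_ ->]]; rewrite ?inE.
  rewrite (mulrCA _ _ (w q)) mulrA [leRHS]mulrC; apply: ler_wpM2l => //.
  have : #|S|%:R <= #|A|%:R :> K by rewrite ler_nat max_card.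
  rewrite -[1 *+ _]/(#|S|%:R); have := cS q; nra.
have [a aS aw] := exists_le_average cS0 hit.
have [abad aval] : a \notin bad /\ exists q, a \in good q.
  by move: aS; rewrite inE => /andP[-> /existsP].
have nc b : b \in s -> ~~ confl b a.
  move=> bs; apply: contra abad => cab; apply/bigcupP; exists b => //.
  by rewrite inE.
have aNs : a \notin s by apply/negP => /nc; rewrite cxx.
exists (a |: s); split.
- by rewrite cardsU1 aNs sk.
- by move=> b; rewrite !inE => /predU1P[->//|/sg].
- move=> b c; rewrite !inE => /predU1P[->|bs] /predU1P[->|cs].
  + by rewrite eqxx.
  + by rewrite cC nc.
  + by rewrite nc.
  + exact: sc.
rewrite exprS mulrCA.
apply: (@le_trans _ _ ((1 - ga / 4) * \sum_q w q)); last first.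
  (* If [ga > 4], then [good q] would be larger than [A]. *)
  have [ga4|ga4] := leP ga 4; first by apply: ler_wpM2l => //; lra.
  have /card_gt0P[q _] := Q0.
  have := goodq q; have : #|good q|%:R <= #|A|%:R :> K by rewrite ler_nat max_card.
  by move: cA ga4; nra.
apply: le_trans aw; apply: ler_sum => q _; rewrite /w.
case: (boolP (a \in good q)) => aq.
  rewrite setIUl (setIidPl _) ?sub1set // cardsU1 !inE (negPf aNs) /= exprS.
  by rewrite mulrC -[1 - 1 / 2]/(1 - 1 / 2); lra.
rewrite mul0r subr0 mulr1 setIUl (_ : [set a] :&: good q = set0) ?set0U //.
by apply/setP => b; rewrite !inE; apply/negP => /andP[/eqP ->]; apply/negP.
Qed.

(** * Partial rainbow matchings *)

(** [R] has to contain the chosen edges but need not be covered by them. This allows [R] to grow and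
    [Cs] to shrink, and pieces on disjoint colours and vertices to be glued. *)
Definition matchable (T C : finType) (E : C -> {set {set T}}) (Cs : {set C})
    (R : {set T}) : Prop :=
  exists e : C -> {set T},
    {in Cs, forall c, e c \in E c /\ e c \subset R} /\
    {in Cs &, forall c d, c != d -> [disjoint e c & e d]}.

Section Matchable.
Variables (T C : finType) (E : C -> {set {set T}}).

Lemma matchable0 (R : {set T}) : matchable E set0 R.
Proof. by exists (fun=> set0); split => [c|c d]; rewrite inE. Qed.

Lemma matchable1 (c : C) (f : {set T}) : f \in E c -> matchable E [set c] f.
Proof.
move=> fE; exists (fun=> f); split=> [d /set1P -> //|d d'].
by move=> /set1P -> /set1P ->; rewrite eqxx.
Qed.

Lemma matchableU (C1 C2 : {set C}) (R1 R2 : {set T}) :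
  [disjoint C1 & C2] -> [disjoint R1 & R2] ->
  matchable E C1 R1 -> matchable E C2 R2 -> matchable E (C1 :|: C2) (R1 :|: R2).
Proof.
move=> dC dR [e1 [e1E e1d]] [e2 [e2E e2d]].
have n1 c : c \in C2 -> (c \in C1) = false.
  by move=> c2; apply: contraTF c2 => /(disjointFr dC) ->.
exists (fun c => if c \in C1 then e1 c else e2 c); split.
  move=> c; rewrite inE; case: ifPn => [c1 _|_ /= c2].
    by have [? s1] := e1E _ c1; rewrite subsetU ?s1.
  by have [? s2] := e2E _ c2; rewrite subsetU ?s2 ?orbT.
move=> c d; rewrite !inE; case: ifPn => [c1 _|_ /= c2];
  case: ifPn => [d1 _|_ /= d2].
- exact: e1d.
- have [_ s1] := e1E _ c1; have [_ s2] := e2E _ d2 => _.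
  exact: disjointW s1 s2 dR.
- have [_ s2] := e2E _ c2; have [_ s1] := e1E _ d1 => _.
  by rewrite disjoint_sym; exact: disjointW s1 s2 dR.
- exact: e2d.
Qed.

Lemma matchable_bigcup (I : finType) (s : {set I}) (Cf : I -> {set C})
    (Rf : I -> {set T}) :
  {in s &, forall i j, i != j ->
    [disjoint Cf i & Cf j] /\ [disjoint Rf i & Rf j]} ->
  {in s, forall i, matchable E (Cf i) (Rf i)} ->
  matchable E (\bigcup_(i in s) Cf i) (\bigcup_(i in s) Rf i).
Proof.
move: {2}#|s| (erefl #|s|) => k; elim: k s => [|k IH] s sk dis mat.
  by rewrite (cards0_eq sk) !big_set0; apply: matchable0.
have [i is_] : exists i, i \in s by apply/card_gt0P; rewrite sk.
rewrite !(big_setD1 i is_) /=; apply: matchableU.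
- apply/bigcup_disjointP => j; rewrite !inE => /andP[ji js].
  by rewrite disjoint_sym; have [] := dis _ _ js is_ ji; rewrite 1?disjoint_sym.
- apply/bigcup_disjointP => j; rewrite !inE => /andP[ji js].
  by have [] := dis _ _ is_ js; rewrite 1?eq_sym.
- exact: mat.
- apply: IH.
  + by move: sk; rewrite (cardsD1 i) is_ => -[].
  + by move=> a b; rewrite !inE => /andP[_ ?] /andP[_ ?]; apply: dis.
  + by move=> a; rewrite inE => /andP[_ ?]; apply: mat.
Qed.

End Matchable.

(** * Almost perfect matching by an exponential potential *)

Definition codeg (T : finType) (E : {set {set T}}) (S : {set T}) (v a : T) : nat :=
  #|[set b in S | [set v; a; b] \in E]|.

Lemma codeg_le (T : finType) (E : {set {set T}}) (S : {set T}) (v a : T) :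
  (codeg E S v a <= #|S|)%N.
Proof. by apply: subset_leq_card; apply/subsetP => b; rewrite inE => /andP[]. Qed.

Lemma card_link_fst (T : finType) (E : {set {set T}}) (S : {set T}) (v a : T) :
  a \in S -> #|[set p in link E S v | p.1 == a]| = codeg E S v a.
Proof.
move=> aS; have injp : injective (@pair T T a) by move=> b c [].
rewrite /codeg -[RHS](card_imset _ injp).
apply: eq_card => -[b c]; apply/idP/imsetP.
  rewrite !inE /= => /andP[/andP[/andP[_ cS] bcE] /eqP ba]; subst b.
  by exists c; rewrite ?inE ?cS.
by case=> d; rewrite inE => /andP[dS dE] [-> ->]; rewrite !inE /= aS dS dE eqxx.
Qed.

Lemma card_link_snd (T : finType) (E : {set {set T}}) (S : {set T}) (v a : T) :
  a \in S -> #|[set p in link E S v | p.2 == a]| = codeg E S v a.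
Proof.
move=> aS; rewrite -(card_link_fst E v aS).
have swapK : involutive (fun p : T * T => (p.2, p.1)) by case.
rewrite -[RHS](card_imset _ (inv_inj swapK)).
apply: eq_card => -[b c]; apply/idP/imsetP; last first.
  case=> -[d f] h [-> ->]; move: h.
  by rewrite !(in_set (fun p => (p \in link E S v) && _)) mem_linkC.
move=> h; exists (c, b) => //; move: h.
by rewrite !(in_set (fun p => (p \in link E S v) && _)) mem_linkC.
Qed.

Lemma sum_codeg (T : finType) (E : {set {set T}}) (S : {set T}) (v : T) :
  (\sum_(a in S) codeg E S v a = #|link E S v|)%N.
Proof.
rewrite -[RHS]sum1_card (partition_big fst (mem S)) /=; last first.
  by move=> [a b]; rewrite mem_link => /and3P[].
apply: eq_bigr => a aS; rewrite -card_link_fst // -sum1_card.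
by apply: eq_bigl => p; rewrite inE.
Qed.

(** A lost pair has a coordinate among [a], [b], [d]; each of these accounts for its codegree once
    per coordinate. *)
Lemma card_link_remove (T : finType) (E : {set {set T}}) (S : {set T})
    (v a b d : T) :
  a \in S -> b \in S -> d \in S ->
  (#|link E S v| <= #|link E (S :\: [set a; b; d]) v| +
     2 * (codeg E S v a + codeg E S v b + codeg E S v d))%N.
Proof.
move=> aS bS dS.
pose F x := [set p in link E S v | p.1 == x] :|: [set p in link E S v | p.2 == x].
have cF x : x \in S -> (#|F x| <= 2 * codeg E S v x)%N.
  move=> xS; rewrite (leq_trans (leq_card_setU _ _)) //.
  by rewrite card_link_fst // card_link_snd // mul2n addnn.
have sub : link E S v \subset
    link E (S :\: [set a; b; d]) v :|: (F a :|: F b :|: F d).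
  apply/subsetP => -[x z] xzL; move: (xzL); rewrite mem_link => /and3P[xS zS xzE].
  rewrite !inE /= xS zS xzE /= !andbT.
  by case: (x == a); case: (x == b); case: (x == d); case: (z == a); case: (z == b);
     case: (z == d).
apply: leq_trans (subset_leq_card sub) _.
have := leq_card_setU (link E (S :\: [set a; b; d]) v) (F a :|: F b :|: F d).
have := leq_card_setU (F a :|: F b) (F d); have := leq_card_setU (F a) (F b).
have := cF _ aS; have := cF _ bS; have := cF _ dS.
move=> ? ? ? [? _] [? _] [? _]; lia.
Qed.

(** From [1 - z <= expR (- z)] one gets [(1 - z) * expR z <= 1], while [(1 - z) * (1 + z + 2 * z ^+
    2) = 1 + z ^+ 2 * (1 - 2 * z)] is at least 1. *)
Lemma expR_le_quadratic (K : realType) (z : K) :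
  `|z| <= 1 / 2 -> expR z <= 1 + z + 2 * z ^+ 2.
Proof.
rewrite ler_norml => /andP[z1 z2].
have := expR_ge1Dx (- z); rewrite expRN => inv1.
have e0 := expR_gt0 z.
have : (1 - z) * expR z <= 1 by rewrite -ler_pdivlMr // div1r.
nra.
Qed.

(** [D] and [D'] stand for the size of a link before and after an edge is removed from [r] vertices,
    [s] for the sum of the three codegrees, whose mean is [3 / r * D]. The loss of density is linear
    in the excess of [s] over this mean, up to an error of order [1 / r ^+ 2]; the exponential is
    then expanded to second order. *)
Lemma expR_link_step (K : realType) (x0 D D' s r lam : K) :
  D <= D' + 2 * s -> 0 <= s -> s <= 3 * r -> 0 <= D -> D <= r ^+ 2 -> 0 <= D' ->
  6 <= r -> 0 <= lam -> 24 * lam <= r ->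
  expR (lam * (x0 - D' / (r - 3) ^+ 2)) <= expR (lam * (x0 - D / r ^+ 2)) *
    (1 + 2 * lam / r ^+ 2 * (s - 3 / r * D) + (36 * lam + 288 * lam ^+ 2) / r ^+ 2).
Proof.
move=> DD s0 s3 D0 Dr D'0 r6 lam0 lamr.
have r0 : 0 < r by lra.
have r30 : 0 < r - 3 by lra.
pose t := 3 / r * D.
have tr : t * r = 3 * D by rewrite /t; field; rewrite gt_eqF.
have t0 : 0 <= t by rewrite /t mulr_ge0 ?divr_ge0 ?(ltW r0).
have t3 : t <= 3 * r by rewrite -(ler_pM2r r0) tr; nra.
(* The 36 absorbs the term [12 * s <= 36 * r] in the expansion of [(D - 2 * s) * (r + 6)]. *)
pose u := (2 * (s - t) + 36) / r ^+ 2.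
have ur : u * r ^+ 2 = 2 * (s - t) + 36 by rewrite /u divfK // expf_neq0 ?gt_eqF.
have step : D / r ^+ 2 - D' / (r - 3) ^+ 2 <= u.
  have r2 : 0 < r ^+ 2 by rewrite exprn_gt0.
  have -> : u = (D / r ^+ 2) - (D - 2 * (s - t) - 36) / r ^+ 2.
    by rewrite -mulrBl /u; congr (_ / _); ring.
  rewrite lerD2l lerN2 ler_pdivlMr ?exprn_gt0 // mulrAC ler_pdivrMr //.
  have Xr : (D - 2 * (s - t) - 36) * r <= D' * (r + 6).
    have : (D - 2 * s) * (r + 6) <= D' * (r + 6) by rewrite ler_pM2r; lra.
    by move: tr; nra.
  (* The two denominators are compared through [(r + 6) * (r - 3) ^+ 2 <= r ^+ 3]. *)
  rewrite -(ler_pM2r r0) mulrAC.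
  apply: (@le_trans _ _ (D' * (r + 6) * (r - 3) ^+ 2)).
    by rewrite ler_wpM2r // sqr_ge0.
  by rewrite -!mulrA ler_wpM2l //; nra.
have lu : `|lam * u| <= 12 * lam / r.
  have u1 : u <= 12 / r.
    rewrite ler_pdivlMr // -(ler_pM2r r0) -mulrA -expr2 ur; nra.
  have u2 : - (12 / r) <= u.
    rewrite lerNl ler_pdivlMr // -(ler_pM2r r0) -mulrA mulNr -expr2 ur; nra.
  rewrite normrM ger0_norm // (mulrC 12) -mulrA; apply: ler_wpM2l => //.
  by rewrite ler_norml u1 u2.
have lu2 : `|lam * u| <= 1 / 2.
  by apply: le_trans lu _; rewrite ler_pdivrMr //; lra.
have -> : lam * (x0 - D' / (r - 3) ^+ 2) =
    lam * (x0 - D / r ^+ 2) + lam * (D / r ^+ 2 - D' / (r - 3) ^+ 2) by ring.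
rewrite expRD ler_pM2l ?expR_gt0 //.
apply: (@le_trans _ _ (expR (lam * u))); first by rewrite ler_expR ler_wpM2l.
apply: le_trans (expR_le_quadratic lu2) _.
have sq : (lam * u) ^+ 2 <= (12 * lam / r) ^+ 2.
  by rewrite -real_normK ?num_real // ler_sqr // ?nnegrE //; apply: le_trans lu.
have ue : lam * u = 2 * lam / r ^+ 2 * (s - t) + 36 * lam / r ^+ 2.
  by rewrite /u; field; rewrite gt_eqF.
have e : 2 * (12 * lam / r) ^+ 2 = 288 * lam ^+ 2 / r ^+ 2.
  by field; rewrite gt_eqF.
rewrite -/t [(36 * lam + _) / _]mulrDl -e; move: sq; rewrite {2}ue; lra.
Qed.

Section Nibble.
Variables (K : realType) (T C : finType) (E : C -> {set {set T}}).
Hypothesis E3 : forall c, uniform3 (E c).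
Variables (x0 : C -> T -> K) (lam : K).
Hypothesis lam0 : 0 < lam.

Definition linkdens (S : {set T}) (c : C) (v : T) : K :=
  #|link (E c) S v|%:R / #|S|%:R ^+ 2.

(** A soft maximum of the deficits of link densities below the targets [x0]. The index set stays
    fixed while colours and vertices are used up, so successive values are sums over the same
    pairs. *)
Definition potential (S : {set T}) : K :=
  \sum_(p : C * T) expR (lam * (x0 p.1 p.2 - linkdens S p.1 p.2)).

Lemma le_potential (S : {set T}) (c : C) (v : T) :
  expR (lam * (x0 c v - linkdens S c v)) <= potential S.
Proof.
rewrite /potential (bigD1 (c, v)) //= lerDl.
by apply: sumr_ge0 => p _; apply: expR_ge0.
Qed.

Lemma linkdens_ge (S : {set T}) (eps : K) (c : C) (v : T) :
  potential S <= expR (lam * eps) -> x0 c v - eps <= linkdens S c v.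
Proof.
move=> /(le_trans (le_potential S c v)); rewrite ler_expR ler_pM2l //; lra.
Qed.

(* [light_edge] is applied to the (linearised) gradient of the potential. *)
Lemma potential_step (S : {set T}) (c : C) (eps : K) :
  (6 <= #|S|)%N -> 24 * lam <= #|S|%:R ->
  potential S <= expR (lam * eps) ->
  (forall v, eps < x0 c v) ->
  (forall u v w, [set u; v; w] \in E c -> 4 / 3 + 2 * eps < x0 c u + x0 c v) ->
  exists e, [/\ e \in E c, e \subset S &
    potential (S :\: e) <=
      potential S * (1 + (36 * lam + 288 * lam ^+ 2) / #|S|%:R ^+ 2)].
Proof.
move=> S6 Slam pot x0eps ore.
set r : K := #|S|%:R in Slam *.
have r6 : 6 <= r by rewrite (ler_nat K 6).
have r0 : 0 < r by lra.
have r20 : 0 < r ^+ 2 by rewrite exprn_gt0.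
pose w (p : C * T) := expR (lam * (x0 p.1 p.2 - linkdens S p.1 p.2)).
have w0 p : 0 <= w p by apply: expR_ge0.
(* [y a] weighs the link pairs starting with [a]; up to a constant factor it is the first-order cost
   of removing [a]. *)
pose y a : K := \sum_p w p * (codeg (E p.1) S p.2 a)%:R.
have [||u v z uS vS zS uvz|a [b [d [aS bS dS abd ley]]]] :=
    @light_edge K T (E c) S y.
- by rewrite -card_gt0; apply: leq_trans S6.
- move=> v _; rewrite -card_gt0 -(ltr_nat K).
  have : 0 < linkdens S c v.
    by have := linkdens_ge c v pot; have := x0eps v; lra.
  by rewrite /linkdens pmulr_lgt0 // invr_gt0.
- have ou := linkdens_ge c u pot; have ov := linkdens_ge c v pot.
  have : 4 / 3 < linkdens S c u + linkdens S c v by have := ore _ _ _ uvz; lra.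
  rewrite /linkdens -/r -mulrDl ltr_pdivlMr // => lt.
  by rewrite -mulnn -(ltr_nat K) !natrM natrD -/r; move: lt; rewrite expr2; lra.
exists [set a; b; d]; split => //.
  by apply/subsetP => i; rewrite !inE => /orP[/orP[]|] /eqP ->.
have cS : #|S :\: [set a; b; d]|%:R = r - 3 :> K.
  rewrite cardsDS; last by apply/subsetP => i; rewrite !inE => /orP[/orP[]|] /eqP ->.
  by rewrite (E3 abd) natrB //; apply: leq_trans S6.
pose s p : K := (codeg (E p.1) S p.2 a)%:R + (codeg (E p.1) S p.2 b)%:R +
  (codeg (E p.1) S p.2 d)%:R.
pose D (p : C * T) : K := #|link (E p.1) S p.2|%:R.
pose rho := (36 * lam + 288 * lam ^+ 2) / r ^+ 2.
apply: (@le_trans _ _ (\sum_p w p *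
    (1 + 2 * lam / r ^+ 2 * (s p - 3 / r * D p) + rho))).
  apply: ler_sum => -[i v] _; rewrite /w /linkdens cS /= -/r.
  apply: expR_link_step => //.
  - by rewrite /s -!natrD -natrM -natrD ler_nat card_link_remove.
  - by rewrite /s -!natrD ler0n.
  - have le t : (codeg (E i) S v t)%:R <= r by rewrite ler_nat codeg_le.
    by have := le a; have := le b; have := le d; rewrite /s /=; lra.
  - by rewrite -natrX ler_nat card_link_le.
  - exact: ltW.
have sy : \sum_p w p * s p = y a + y b + y d.
  by rewrite -!big_split; apply: eq_bigr => p _; rewrite /= -!mulrDr.
have sD : \sum_p w p * D p = \sum_(v in S) y v.
  rewrite exchange_big /=; apply: eq_bigr => p _.
  by rewrite -mulr_sumr -natr_sum sum_codeg.
have -> : \sum_p w p * (1 + 2 * lam / r ^+ 2 * (s p - 3 / r * D p) + rho) =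
    potential S * (1 + rho) + 2 * lam / r ^+ 2 *
      (\sum_p w p * s p - 3 / r * \sum_p w p * D p).
  rewrite mulr_suml mulr_sumr -sumrB mulr_sumr -big_split /=.
  by apply: eq_bigr => p _; rewrite -/(w p); ring.
(* The choice of the light edge makes the linear term nonpositive; only [rho] remains. *)
rewrite sy sD gerDl mulr_ge0_le0 ?subr_le0 //.
by rewrite divr_ge0 ?mulr_ge0 ?(ltW lam0) ?(ltW r20).
Qed.

(** Colours are removed one by one until at most [h] are left. Before that, [S0] has at least
    [3 * h] vertices, so a step costs a factor at most [1 + rho]. The power of [1 + rho] in the
    hypothesis pays for all steps in advance and keeps the potential below the threshold of
    [potential_step]. *)
Lemma nibble (eps rho : K) (h : nat) (C0 : {set C}) (S0 : {set T}) :
  (forall c v, eps < x0 c v) ->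
  (forall c u v w, [set u; v; w] \in E c ->
    4 / 3 + 2 * eps < x0 c u + x0 c v) ->
  (0 < h)%N -> 24 * lam <= (3 * h)%:R ->
  36 * lam + 288 * lam ^+ 2 <= rho * (3 * h)%:R ^+ 2 ->
  #|S0| = (3 * #|C0|)%N ->
  potential S0 * (1 + rho) ^+ #|C0| <= expR (lam * eps) ->
  exists (C1 : {set C}) (S1 : {set T}),
    [/\ C1 \subset C0, S1 \subset S0, (#|C1| <= h)%N, #|S1| = (3 * #|C1|)%N &
      matchable E (C0 :\: C1) (S0 :\: S1)].
Proof.
move=> x0eps ore h0 lamh rhoh.
have rho0 : 0 <= rho.
  have h2 : 0 < (3 * h)%:R ^+ 2 :> K by rewrite exprn_gt0 // ltr0n muln_gt0.
  rewrite -(pmulr_lge0 _ h2); apply: le_trans rhoh.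
  by rewrite addr_ge0 ?mulr_ge0 ?sqr_ge0 ?(ltW lam0).
move: {2}#|C0| (erefl #|C0|) => k; elim: k C0 S0 => [|k IH] C0 S0 Ck SC pot.
  exists C0, S0; rewrite !setDv; split=> //; first by rewrite Ck.
  exact: matchable0.
have [Ch|Ch] := leqP #|C0| h.
  exists C0, S0; rewrite !setDv; split=> //; exact: matchable0.
have [c cC0] : exists c, c \in C0 by apply/card_gt0P; rewrite Ck.
have pot1 : potential S0 <= expR (lam * eps).
  apply: le_trans pot; rewrite ler_peMr ?sumr_ge0 // => [p _|].
    exact: expR_ge0.
  by rewrite exprn_ege1 // lerDl.
have Sh : ((3 * h)%:R <= #|S0|%:R :> K) by rewrite ler_nat SC leq_mul2l ltnW ?orbT.
have [|||u v w|e [eE eS pote]] := @potential_step S0 c eps _ _ pot1.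
- by rewrite SC; apply: (@leq_mul 3 2) => //; apply: leq_ltn_trans h0 Ch.
- exact: le_trans Sh.
- exact: x0eps.
- exact: ore.
have S0gt : 0 < #|S0|%:R :> K by rewrite ltr0n SC Ck.
have C0c : #|C0| = (#|C0 :\ c|).+1 by rewrite (cardsD1 c) cC0.
have Se : #|S0 :\: e| = (3 * #|C0 :\ c|)%N.
  by rewrite cardsDS // (E3 eE) SC C0c mulnS addKn.
have [||C1 [S1 [CC SS Ch1 S1C mat]]] := IH (C0 :\ c) (S0 :\: e) _ Se.
- by move: Ck; rewrite C0c => -[].
- apply: le_trans pot; rewrite C0c exprS mulrA.
  rewrite ler_wpM2r ?exprn_ge0 ?addr_ge0 //; apply: le_trans pote _.
  rewrite ler_wpM2l ?sumr_ge0 // => [p _|]; first exact: expR_ge0.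
  rewrite lerD2l ler_pdivrMr ?exprn_gt0 //; apply: le_trans rhoh _.
  by rewrite ler_wpM2l // ler_sqr ?nnegrE ?ler0n.
exists C1, S1; split=> //.
- exact: subset_trans CC (subsetDl _ _).
- exact: subset_trans SS (subsetDl _ _).
have -> : C0 :\: C1 = [set c] :|: (C0 :\ c) :\: C1.
  apply/setP => d; rewrite !inE; case: eqP => [->|] //=; rewrite cC0 andbT.
  by apply/negP => /(subsetP CC); rewrite !inE eqxx.
have -> : S0 :\: S1 = e :|: (S0 :\: e) :\: S1.
  apply/setP => t; rewrite !inE; case: (boolP (t \in e)) => //= te.
  rewrite (subsetP eS _ te) andbT.
  by apply/negP => /(subsetP SS); rewrite !inE te.
apply: matchableU => //; last exact: matchable1.
- by rewrite disjoints1 !inE eqxx andbF.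
- by apply/pred0P => t; rewrite /= !inE; case: (t \in e); rewrite ?andbF.
Qed.

End Nibble.

(** * Counting the absorbers of a quadruple *)

Lemma card_fibers (A B : finType) (P : A -> B -> bool) :
  (#|[set p : A * B | P p.1 p.2]| = \sum_a #|[set b | P a b]|)%N.
Proof.
under eq_bigr do rewrite -sum1_card.
rewrite -sum1_card (pair_big_dep xpredT (fun a b => b \in [set b | P a b])) /=.
by apply: eq_bigl => p; rewrite !inE.
Qed.

Lemma cardsI_ge (K : realFieldType) (A : finType) (X Y Z : {set A}) :
  X \subset Z -> Y \subset Z ->
  #|X|%:R + #|Y|%:R - #|Z|%:R <= #|X :&: Y|%:R :> K.
Proof.
move=> XZ YZ; rewrite lerBlDr -!natrD ler_nat.
by rewrite -(cardsUI X Y) addnC leq_add2l subset_leq_card // subUset XZ.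
Qed.

Section Absorbers.
Variables (K : realType) (T C : finType) (E : C -> {set {set T}}).
Hypothesis TC : #|T| = (3 * #|C|)%N.
Variable delta : K.
Hypothesis delta0 : 0 < delta.
Notation N := (#|T|%:R).
Notation D c v := (#|link (E c) setT v|%:R).
Hypothesis ore : forall c u v w, [set u; v; w] \in E c ->
  (4 / 3 + 2 * delta) * N ^+ 2 <= D c u + D c v.
Hypothesis mindeg : forall c v, (1 / 3 + 2 * delta) * N ^+ 2 <= D c v.
Hypothesis C0 : (0 < #|C|)%N.

Let N0 : 0 < N :> K. Proof. by rewrite ltr0n TC muln_gt0. Qed.

Let dN0 : 0 < delta * N ^+ 2. Proof. by rewrite mulr_gt0 ?exprn_gt0. Qed.

Lemma card_setTT : #|setX [set: T] [set: T]|%:R = N ^+ 2 :> K.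
Proof. by rewrite cardsX cardsT natrM expr2. Qed.

Lemma delta_le : delta <= 1 / 3.
Proof.
have /card_gt0P[c _] := C0; have : (0 < #|T|)%N by rewrite -(ltr_nat K).
move=> /card_gt0P[v _]; have := mindeg c v.
have : D c v <= N ^+ 2 :> K by rewrite -natrX ler_nat -cardsT card_link_le.
have N20 : 0 < N ^+ 2 :> K by rewrite exprn_gt0.
by move=> hi lo; rewrite -(ler_pM2r N20); lra.
Qed.

Definition adjs c x := [set y | [exists w, [set x; y; w] \in E c]].

Definition common c x y := link (E c) setT x :&: link (E c) setT y.

Lemma adjs_common c x y : y \in adjs c x -> N ^+ 2 / 3 <= #|common c x y|%:R :> K.
Proof.
rewrite inE => /existsP[w xyw].
have := cardsI_ge K (link_sub (E c) setT x) (link_sub (E c) setT y).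
by rewrite card_setTT -/(common c x y); move: (ore xyw) dN0; lra.
Qed.

Lemma link_adjs c x : D c x <= #|adjs c x|%:R ^+ 2 :> K.
Proof.
rewrite expr2 -natrM ler_nat -cardsX subset_leq_card //.
apply/subsetP => -[a b]; rewrite mem_link !inE /= => abE.
by apply/andP; split; apply/existsP; [exists b|exists a; rewrite set3CA].
Qed.

Definition oftadj x :=
  [set y | delta / 2 * #|C|%:R <= #|[set c | y \in adjs c x]|%:R].

(** Averaging over colours, a vertex outside [oftadj x] counts in less than a [delta / 2] fraction
    of them, so in some colour [x] has at most [#|oftadj x| + delta / 2 * N] neighbours. Their
    number squared bounds the link of [x], and the slack [2 * delta] in [mindeg] covers the loss. *)
Lemma card_oftadj x : N ^+ 2 / 3 <= #|oftadj x|%:R ^+ 2 :> K.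
Proof.
have [c _] : exists2 c, c \in [set: C] &
    #|adjs c x|%:R <= #|oftadj x|%:R + delta / 2 * N.
  apply: exists_le_average; first by rewrite -card_gt0 cardsT.
  have -> : \sum_(c in [set: C]) #|adjs c x|%:R =
      \sum_y #|[set c | y \in adjs c x]|%:R :> K.
    rewrite -!natr_sum; congr (_%:R).
    rewrite -(card_fibers (fun y c => y \in adjs c x)).
    under eq_bigl do rewrite inE.
    have swap_inj : injective (fun p : T * C => (p.2, p.1)).
      by move=> [? ?] [? ?] [-> ->].
    rewrite -[RHS](card_imset _ swap_inj).
    have := card_fibers (fun c y => y \in adjs c x).
    under eq_bigr => c _.
      rewrite (_ : [set b | b \in adjs c x] = adjs c x); last first.
        by apply/setP => y; rewrite [LHS]inE.
      over.
    move=> <-; apply: eq_card => -[c y]; apply/idP/imsetP.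
      by rewrite inE /= => yc; exists (y, c); rewrite // inE.
    by case=> -[y' c']; rewrite inE /= => yc [-> ->]; rewrite inE.
  rewrite (bigID (mem (oftadj x))) /= cardsT mulrDr; apply: lerD.
    rewrite mulrC mulr_natl -sumr_const; apply: ler_sum => y _.
    by rewrite ler_nat max_card.
  apply: (@le_trans _ _ (\sum_(y : T) delta / 2 * #|C|%:R)).
    rewrite big_mkcond /=; apply: ler_sum => y _; case: ifPn => [|_].
      by rewrite inE -ltNge => /ltW.
    by rewrite mulr_ge0 ?divr_ge0 ?(ltW delta0).
  by rewrite sumr_const -mulr_natr; lra.
move=> le; have := link_adjs c x; have := mindeg c x; have := delta_le.
have oN : #|oftadj x|%:R <= N :> K by rewrite ler_nat max_card.
have a0 : 0 <= #|adjs c x|%:R :> K by [].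
have o0 : 0 <= #|oftadj x|%:R :> K by [].
set a := #|adjs c x|%:R in le a0 *; set o := #|oftadj x|%:R in le oN o0 *.
move=> d3 lo hi.
have : a ^+ 2 <= (o + delta / 2 * N) ^+ 2.
  by rewrite ler_sqr // nnegrE (le_trans a0).
have : delta * N * (N - o) >= 0 by rewrite !mulr_ge0 ?subr_ge0 ?(ltW N0) ?(ltW delta0).
have : 0 < delta * N ^+ 2 by rewrite mulr_gt0 ?exprn_gt0.
nra.
Qed.

Definition low c := [set v | D c v < (2 / 3 + delta) * N ^+ 2].

(* Two low vertices are never adjacent, so the link of a low vertex avoids [low c]
   and the link of one of its neighbours avoids [low c * low c]. *)
Lemma card_low c : #|low c|%:R <= N / 3 :> K.
Proof.
have [->|[x xl]] := set_0Vmem (low c); first by rewrite cards0 divr_ge0 ?(ltW N0).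
have lowN u v w : [set u; v; w] \in E c -> u \in low c -> v \in low c -> False.
  by move=> /ore uvw; rewrite !inE; lra.
have : 0 < D c x :> K.
  by apply: lt_le_trans (mindeg c x); rewrite mulr_gt0 ?exprn_gt0 //; move: delta0; lra.
rewrite ltr0n => /card_gt0P[[u w]]; rewrite mem_link => /and3P[_ _ xuw].
have := ore xuw.
have lx : D c x <= #|~: low c|%:R ^+ 2 :> K.
  rewrite expr2 -natrM ler_nat -cardsX subset_leq_card //.
  apply/subsetP => -[a b]; rewrite mem_link in_setX !in_setC => /and3P[_ _ abE].
  apply/andP; split; apply/negP => /= al; apply: lowN xl al => //; first exact: abE.
  by rewrite set3CA in abE; exact: abE.
have lu : D c u + #|low c|%:R ^+ 2 <= N ^+ 2 :> K.
  rewrite expr2 -natrM -natrD -cardsX -natrX -cardsT -mulnn -cardsX ler_nat.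
  have -> : (#|link (E c) [set: T] u| + #|setX (low c) (low c)| =
             #|link (E c) [set: T] u :|: setX (low c) (low c)|)%N.
    apply/eqP; rewrite eq_sym (leq_card_setU _ _); apply/pred0P => -[a b].
    rewrite /= mem_link in_setX /=; apply/negP => /andP[/and3P[_ _ uab] /andP[al bl]].
    apply: (lowN a b u) al bl.
    by rewrite set3CA set3C set3CA in uab; move: uab; rewrite set3C set3CA set3C.
  by apply: subset_leq_card; apply/subsetP => -[a b]; rewrite !inE.
have e : #|~: low c|%:R = N - #|low c|%:R :> K.
  by rewrite -(cardsC (low c)) natrD addrAC subrr add0r.
rewrite e in lx; set l := #|low c|%:R in lx lu *.
have : 0 < N :> K by [].
(* The two links have at most [(N - l) ^+ 2 + N ^+ 2 - l ^+ 2 = 2 * N * (N - l)] pairs together, to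
   be compared with [4 / 3 * N ^+ 2]. *)
move=> Np h; have : N * (3 * l - N) <= 0.
  have : 0 <= delta * N ^+ 2 by rewrite mulr_ge0 ?sqr_ge0 // ltW.
  nra.
by rewrite pmulr_rle0 //; lra.
Qed.

(** At least [N / 2 - N / 3] vertices of [Y1] are not low. The link of such a vertex has at least
    [(2 / 3 + delta) * N ^+ 2] pairs and [setX Y2 Y3] at least [N ^+ 2 / 3], so they share
    [delta * N ^+ 2]. *)
Lemma card_triples c (Y1 Y2 Y3 : {set T}) :
  N ^+ 2 / 3 <= #|Y1|%:R ^+ 2 :> K -> N ^+ 2 / 3 <= #|Y2|%:R ^+ 2 :> K ->
  N ^+ 2 / 3 <= #|Y3|%:R ^+ 2 :> K ->
  delta / 6 * N ^+ 3 <=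
    #|[set p : T * (T * T) | (p.1 \in Y1) && (p.2 \in setX Y2 Y3 :&:
        link (E c) setT p.1)]|%:R.
Proof.
move=> h1 h2 h3; rewrite (card_fibers (fun a b => (a \in Y1) &&
  (b \in setX Y2 Y3 :&: link (E c) setT a))).
have y1 : N / 6 <= #|Y1 :\: low c|%:R :> K.
  have : N / 2 <= #|Y1|%:R :> K.
    rewrite -ler_sqr ?nnegrE ?divr_ge0 ?(ltW N0) //; apply: le_trans h1.
    by have := exprn_gt0 2 N0; lra.
  have : #|Y1|%:R <= #|Y1 :\: low c|%:R + #|low c|%:R :> K.
    rewrite -natrD ler_nat -(cardsID (low c) Y1) addnC leq_add2l.
    by rewrite subset_leq_card // subsetIr.
  by have := card_low c; lra.
have y23 : N ^+ 2 / 3 <= #|setX Y2 Y3|%:R :> K.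
  rewrite cardsX natrM -ler_sqr ?nnegrE ?mulr_ge0 ?invr_ge0 ?sqr_ge0 //.
  by rewrite [leRHS]exprMn [leLHS]expr2 ler_pM ?divr_ge0 ?sqr_ge0.
rewrite natr_sum.
apply: (@le_trans _ _ (\sum_(a in Y1 :\: low c) delta * N ^+ 2)).
  rewrite sumr_const -mulr_natl.
  have : 0 < delta * N ^+ 2 by rewrite mulr_gt0 ?exprn_gt0.
  by rewrite exprSr; nra.
rewrite big_mkcond /=; apply: ler_sum => a _; case: ifPn => [|_]; last exact: ler0n.
rewrite !inE -leNgt => /andP[hi aY].
have -> : [set b | (a \in Y1) && (b \in setX Y2 Y3 :&: link (E c) setT a)] =
    setX Y2 Y3 :&: link (E c) setT a by apply/setP => b; rewrite !inE aY.
have sub : setX Y2 Y3 \subset setX setT setT by apply/subsetP => p; rewrite !inE.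
have := cardsI_ge K sub (link_sub (E c) setT a).
by rewrite card_setTT; apply: le_trans; move: y23 hi; lra.
Qed.


Definition gpt (g : C * T * T * T) : T := g.1.1.2.

Definition accepts (x : T) (g : C * T * T * T) : bool :=
  ((g.1.2, g.2) \in common g.1.1.1 x (gpt g)).

(** At least [delta / 2 * #|C|] colours make [x] and [y] adjacent, and each gives [N ^+ 2 / 3]
    common pairs. *)
Lemma card_accepts x y : y \in oftadj x ->
  delta / 6 * #|C|%:R * N ^+ 2 <= #|[set g | (gpt g == y) && accepts x g]|%:R.
Proof.
rewrite inE => yx.
pose S := [set p : C * (T * T) | p.2 \in common p.1 x y].
have cS : (#|S| <= #|[set g | (gpt g == y) && accepts x g]|)%N.
  pose f (p : C * (T * T)) := (p.1, y, p.2.1, p.2.2).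
  have injf : injective f by move=> [c [a b]] [c' [a' b']] [-> -> ->].
  rewrite -(card_imset _ injf); apply: subset_leq_card; apply/subsetP => g.
  case/imsetP => -[c [a b]] pS ->; rewrite in_set /accepts /gpt /= eqxx /=.
  by move: pS; rewrite in_set.
apply: (@le_trans _ _ #|S|%:R); last by rewrite ler_nat.
rewrite (card_fibers (fun c p => p \in common c x y)) natr_sum.
apply: (@le_trans _ _ (\sum_(c in [set c | y \in adjs c x]) N ^+ 2 / 3)).
  rewrite sumr_const -[leRHS]mulr_natl.
  have : 0 <= N ^+ 2 :> K by rewrite sqr_ge0.
  by move: yx; nra.
rewrite big_mkcond /=; apply: ler_sum => c _; case: ifPn => [|_]; last by [].
rewrite inE => /adjs_common /le_trans; apply; rewrite ler_nat.
rewrite (_ : [set p | p \in common c x y] = common c x y) //.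
by apply/setP => p; rewrite [LHS]in_set.
Qed.

(** Distinct colours and disjoint gadgets are required only in [good], so that the count below is a
    plain product. *)
Definition pregood (q : C * T * T * T)
    (A : (C * T * T * T) * (C * T * T * T) * (C * T * T * T)) : bool :=
  [&& [set gpt A.1.1; gpt A.1.2; gpt A.2] \in E q.1.1.1,
      accepts q.1.1.2 A.1.1, accepts q.1.2 A.1.2 & accepts q.2 A.2].

(** There are [delta / 6 * N ^+ 3] triples of exchange vertices, and [delta / 6 * #|C| * N ^+ 2]
    choices for each of the three gadgets; 1296 is the fourth power of 6. *)
Lemma card_pregood q :
  delta ^+ 4 / 1296 * #|{: (C * T * T * T) * (C * T * T * T) * (C * T * T * T)}|%:R
    <= #|[set A | pregood q A]|%:R.
Proof.
case: q => [[[c x1] x2] x3].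
pose Tr := [set p : T * (T * T) | (p.1 \in oftadj x1) &&
  (p.2 \in setX (oftadj x2) (oftadj x3) :&: link (E c) setT p.1)].
have cTr := card_triples c (card_oftadj x1) (card_oftadj x2) (card_oftadj x3).
rewrite -/Tr in cTr.
have TrP y1 y2 y3 : (y1, (y2, y3)) \in Tr ->
    [/\ y1 \in oftadj x1, y2 \in oftadj x2, y3 \in oftadj x3 &
        [set y1; y2; y3] \in E c].
  rewrite in_set /= in_setI in_setX mem_link /=.
  by case/and3P => ? /andP[? ?] /and3P[_ _ ?].
pose G x y := [set g | (gpt g == y) && accepts x g].
pose X (p : T * (T * T)) := setX (setX (G x1 p.1) (G x2 p.2.1)) (G x3 p.2.2).
pose pts (A : (C * T * T * T) * (C * T * T * T) * (C * T * T * T)) :=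
  (gpt A.1.1, (gpt A.1.2, gpt A.2)).
set M := delta / 6 * #|C|%:R * N ^+ 2.
have M0 : 0 <= M by rewrite !mulr_ge0 ?sqr_ge0 ?(ltW delta0) ?invr_ge0.
apply: (@le_trans _ _ (\sum_(p in Tr) M ^+ 3)).
  rewrite sumr_const -[leRHS]mulr_natl.
  have -> : delta ^+ 4 / 1296 *
      #|{: (C * T * T * T) * (C * T * T * T) * (C * T * T * T)}|%:R =
      delta / 6 * N ^+ 3 * M ^+ 3.
    by rewrite !card_prod !natrM /M; field.
  by rewrite ler_wpM2r ?exprn_ge0.
apply: (@le_trans _ _ (\sum_(p in Tr) #|X p|%:R)).
  apply: ler_sum => -[y1 [y2 y3]]; case/TrP => o1 o2 o3 _.
  rewrite !cardsX !natrM exprSr expr2.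
  apply: ler_pM; [exact: mulr_ge0|exact: M0| |exact: card_accepts].
  by apply: ler_pM; [exact: M0|exact: M0|exact: card_accepts|exact: card_accepts].
rewrite -natr_sum ler_nat.
have XP p A : A \in X p -> pts A = p.
  by case: p => y1 [y2 y3]; rewrite !inE /= /pts => /andP[/andP[/andP[/eqP-> _]
    /andP[/eqP-> _]] /andP[/eqP-> _]].
(* [pts] recovers the triple from the absorber, so the sets [X p] are pairwise disjoint. *)
have -> : (\sum_(p in Tr) #|X p| = #|\bigcup_(p in Tr) X p|)%N.
  under eq_bigr do rewrite -sum1_card.
  rewrite -[RHS]sum1_card (partition_big pts (mem Tr)) /=; last first.
    by move=> A /bigcupP[p pT /XP ->].
  apply: eq_bigr => p pT; apply: eq_bigl => A; apply/idP/andP.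
    move=> AX; split; first by apply/bigcupP; exists p.
    by rewrite (XP _ _ AX).
  by case=> /bigcupP[p' _ AX] /eqP <-; rewrite (XP _ _ AX).
apply: subset_leq_card; apply/bigcupsP => -[y1 [y2 y3]].
case/TrP => _ _ _ yE; apply/subsetP => -[[g1 g2] g3].
rewrite !inE /= /pregood => /andP[/andP[/andP[/eqP y1E ->] /andP[/eqP y2E ->]]
  /andP[/eqP y3E ->]].
by rewrite /= y1E y2E y3E yE.
Qed.

End Absorbers.

(** * Overlaps and conflicts *)

Lemma leq_card_setU3 (T : finType) (A B X : {set T}) :
  (#|A :|: B :|: X| <= #|A| + #|B| + #|X|)%N.
Proof.
apply: leq_trans (leq_card_setU _ _) _.
by rewrite leq_add2r (leq_card_setU _ _).
Qed.

Lemma cards3_le (T : finType) (a b c : T) : (#|[set a; b; c]| <= 3)%N.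
Proof.
by have := leq_card_setU3 [set a] [set b] [set c]; rewrite !cards1.
Qed.

Lemma cards3_neq (T : finType) (a b c : T) :
  #|[set a; b; c]| = 3 -> [/\ a != b, a != c & b != c].
Proof. by rewrite setUC cardsU1 cards2 !inE negb_or (eq_sym c a) (eq_sym c b);
  do 3 case: eqP.
Qed.

Lemma disjointUl (T : finType) (A B X : {set T}) :
  [disjoint A :|: B & X] = [disjoint A & X] && [disjoint B & X].
Proof. by rewrite -!setI_eq0 setIUl setU_eq0. Qed.

Lemma disjointUr (T : finType) (A B X : {set T}) :
  [disjoint X & A :|: B] = [disjoint X & A] && [disjoint X & B].
Proof. by rewrite !(disjoint_sym X) disjointUl. Qed.

Lemma disjointU3 (T : finType) (A1 A2 A3 B1 B2 B3 : {set T}) :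
  [disjoint A1 :|: A2 :|: A3 & B1 :|: B2 :|: B3] =
  [&& [&& [disjoint A1 & B1], [disjoint A1 & B2] & [disjoint A1 & B3]],
      [&& [disjoint A2 & B1], [disjoint A2 & B2] & [disjoint A2 & B3]]
    & [&& [disjoint A3 & B1], [disjoint A3 & B2] & [disjoint A3 & B3]]].
Proof. by rewrite !disjointUl !disjointUr -!andbA. Qed.

Section Gadgets.
Variables (T C : finType).
Hypothesis TC : #|T| = (3 * #|C|)%N.
Hypothesis C0 : (0 < #|C|)%N.
Notation gadget := (C * T * T * T)%type.
Notation absorber := (gadget * gadget * gadget)%type.

(* A gadget (c, y, a, b) stands for the edge {y, a, b} of colour c, where y may be
   exchanged for another vertex; the same type encodes the leftover quadruples
   (c, x1, x2, x3). *)
Definition gver (g : gadget) : {set T} := [set g.1.1.2; g.1.2; g.2].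

Definition overlap (g g' : gadget) : bool :=
  (g.1.1.1 == g'.1.1.1) || ~~ [disjoint gver g & gver g'].

Definition acols (A : absorber) : {set C} :=
  [set A.1.1.1.1.1; A.1.2.1.1.1; A.2.1.1.1].

Definition avers (A : absorber) : {set T} := gver A.1.1 :|: gver A.1.2 :|: gver A.2.

Definition conflict (A B : absorber) : bool :=
  ~~ [disjoint acols A & acols B] || ~~ [disjoint avers A & avers B].

Lemma conflictC : symmetric conflict.
Proof. by move=> A B; rewrite /conflict ![[disjoint _ A & _]]disjoint_sym. Qed.

Lemma conflictxx : reflexive conflict.
Proof.
move=> A; apply/orP; left; apply/pred0Pn; exists A.1.1.1.1.1.
by rewrite /= !inE eqxx.
Qed.

Variable K : realFieldType.
Notation N := (#|T|%:R).

Let N0 : 0 < N :> K. Proof. by rewrite ltr0n TC muln_gt0. Qed.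

(** A shared colour leaves [N ^+ 3] gadgets, a fraction [3 / N] because [N = 3 * #|C|]. A shared
    vertex, one of three in one of three positions, leaves a fraction at most [9 / N]. *)
Lemma card_overlap g :
  #|[set g' | overlap g g']|%:R <= 12 / N * #|{: gadget}|%:R :> K.
Proof.
pose F z := setX (setX (setX [set: C] [set z]) [set: T]) [set: T] :|:
  setX (setX (setX [set: C] [set: T]) [set z]) [set: T] :|:
  setX (setX (setX [set: C] [set: T]) [set: T]) [set z].
pose Cg := setX (setX (setX [set g.1.1.1] [set: T]) [set: T]) [set: T].
have sub : [set g' | overlap g g'] \subset Cg :|: \bigcup_(z in gver g) F z.
  apply/subsetP => -[[[c y] a] b]; rewrite in_set => /orP[/eqP /= <-|].
    by rewrite !inE eqxx.
  case/pred0Pn => z /andP[/= zg zg']; apply/setUP; right.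
  apply/bigcupP; exists z => //; move: zg'; rewrite !inE /= !andbT.
  by rewrite ![z == _]eq_sym.
have cF z : #|F z|%:R <= 3 * #|C|%:R * N ^+ 2 :> K.
  have : (#|F z| <= 3 * #|C| * (#|T| * #|T|))%N.
    apply: leq_trans (leq_card_setU3 _ _ _) _.
    by rewrite !cardsX !cardsT !cards1; lia.
  by rewrite -(ler_nat K) !natrM expr2.
apply: (@le_trans _ _ (N ^+ 3 + 3 * (3 * #|C|%:R * N ^+ 2))).
  apply: (@le_trans _ _ (#|Cg|%:R + #|\bigcup_(z in gver g) F z|%:R)).
    rewrite -natrD ler_nat (leq_trans (subset_leq_card sub)) //.
    by have [] := leq_card_setU Cg (\bigcup_(z in gver g) F z).
  apply: lerD.
    by rewrite !cardsX cards1 cardsT !natrM mul1r !exprS expr0 mulr1 mulrA.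
  apply: le_trans (card_bigcup_le (gver g) cF) _.
  by rewrite ler_wpM2r ?mulr_ge0 ?sqr_ge0 // (ler_nat K _ 3) cards3_le.
have e : N = 3 * #|C|%:R :> K by rewrite TC natrM.
rewrite !card_prod !natrM.
have -> : 12 / N * (#|C|%:R * N * N * N) = 12 * #|C|%:R * N ^+ 2 :> K.
  by field; rewrite gt_eqF.
by rewrite exprS {1}e; lra.
Qed.

Notation cA := (#|{: absorber}|%:R).

Lemma card_absorber :
  cA = #|{: gadget}|%:R * #|{: gadget}|%:R * #|{: gadget}|%:R :> K.
Proof.
by rewrite !(card_prod (gadget * gadget)%type, card_prod gadget gadget) !natrM.
Qed.

Lemma card_overlap3 g : #|[set A : absorber | [|| overlap g A.1.1, overlap g A.1.2 |
    overlap g A.2]]|%:R <= 36 / N * cA :> K.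
Proof.
pose O := [set g' | overlap g g'].
pose X1 := setX (setX O [set: gadget]) [set: gadget].
pose X2 := setX (setX [set: gadget] O) [set: gadget].
pose X3 := setX (setX [set: gadget] [set: gadget]) O.
have sub : [set A : absorber | [|| overlap g A.1.1, overlap g A.1.2 |
    overlap g A.2]] \subset X1 :|: X2 :|: X3.
  apply/subsetP => -[[g1 g2] g3]; rewrite in_set !in_setU !in_setX !in_setT /O.
  by rewrite ![_ \in [set g' | overlap g g']]in_set /= !andbT orbA.
have := card_overlap g; rewrite -/O card_absorber.
have : (#|[set A : absorber | [|| overlap g A.1.1, overlap g A.1.2 |
    overlap g A.2]]| <= 3 * (#|O| * (#|{: gadget}| * #|{: gadget}|)))%N.
  apply: leq_trans (subset_leq_card sub) _.
  have c1 : #|X1| = (#|O| * (#|{: gadget}| * #|{: gadget}|))%N.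
    by rewrite !cardsX !cardsT mulnA.
  have c2 : #|X2| = (#|O| * (#|{: gadget}| * #|{: gadget}|))%N.
    by rewrite !cardsX !cardsT (mulnC _ #|O|) mulnA.
  have c3 : #|X3| = (#|O| * (#|{: gadget}| * #|{: gadget}|))%N.
    by rewrite !cardsX !cardsT mulnC.
  by apply: leq_trans (leq_card_setU3 _ _ _) _; rewrite c1 c2 c3 !mulSn mul0n addn0 addnA.
rewrite -(ler_nat K) !natrM => /le_trans le leO; apply: le.
set o := #|O|%:R in leO *; set m := #|{: gadget}|%:R in leO *.
have m0 : 0 <= m * m by rewrite mulr_ge0 ?ler0n.
have -> : 36 / N * (m * m * m) = 3 * (12 / N * m * (m * m)) :> K by ring.
by rewrite ler_wpM2l // ler_wpM2r.
Qed.

(** A conflict is an overlap of one of the three gadgets of [A] with one of the three of [B], whence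
    [9 * 12 = 108]. *)
Lemma card_conflict A :
  #|[set B | conflict A B]|%:R <= 108 / N * cA :> K.
Proof.
pose X g := [set A : absorber | [|| overlap g A.1.1, overlap g A.1.2 | overlap g A.2]].
have sub : [set B | conflict A B] \subset X A.1.1 :|: X A.1.2 :|: X A.2.
  apply/subsetP => B; rewrite in_set !in_setU ![B \in X _]in_set.
  apply: contraLR; rewrite !negb_or !negbK.
  case: A B {X} => [[g1 g2] g3] [[f1 f2] f3] /=.
  case/andP => /andP[/and3P[/andP[c1 d1] /andP[c2 d2] /andP[c3 d3]]
    /and3P[/andP[c4 d4] /andP[c5 d5] /andP[c6 d6]]]
    /and3P[/andP[c7 d7] /andP[c8 d8] /andP[c9 d9]].
  rewrite /acols /avers /= 2!disjointU3 !disjoints1 !inE.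
  by rewrite c1 c2 c3 c4 c5 c6 c7 c8 c9 d1 d2 d3 d4 d5 d6 d7 d8 d9.
have : (#|[set B | conflict A B]| <= #|X A.1.1| + #|X A.1.2| + #|X A.2|)%N.
  exact: leq_trans (subset_leq_card sub) (leq_card_setU3 _ _ _).
rewrite -(ler_nat K) !natrD.
have := card_overlap3 A.1.1; have := card_overlap3 A.1.2; have := card_overlap3 A.2.
by rewrite -!/(X _); lra.
Qed.

Definition selfoverlap (A : absorber) : bool :=
  [|| overlap A.1.1 A.1.2, overlap A.1.1 A.2 | overlap A.1.2 A.2].

Lemma card_selfoverlap : #|[set A | selfoverlap A]|%:R <= 36 / N * cA :> K.
Proof.
pose X12 := setX [set p : gadget * gadget | overlap p.1 p.2] [set: gadget].
pose X13 := [set A : absorber | overlap A.1.1 A.2].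
pose X23 := [set A : absorber | overlap A.1.2 A.2].
have sub : [set A | selfoverlap A] \subset X12 :|: X13 :|: X23.
  apply/subsetP => -[[g1 g2] g3]; rewrite in_set !in_setU in_setX in_setT.
  by rewrite ![_ \in [set _ | _]]in_set /= andbT /selfoverlap orbA.
have : (#|[set A | selfoverlap A]| <= #|X12| + #|X13| + #|X23|)%N.
  exact: leq_trans (subset_leq_card sub) (leq_card_setU3 _ _ _).
rewrite -(ler_nat K) !natrD => /le_trans; apply.
have m0 : 0 <= #|{: gadget}|%:R :> K by [].
have c12 : #|X12|%:R <= 12 / N * cA :> K.
  rewrite cardsX cardsT natrM card_absorber mulrA ler_wpM2r //.
  rewrite (card_fibers overlap) natr_sum.
  apply: (@le_trans _ _ (\sum_(g : gadget) 12 / N * #|{: gadget}|%:R)).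
    by apply: ler_sum => g _; apply: card_overlap.
  by rewrite sumr_const -[leLHS]mulr_natr mulrA.
have c3 (f : gadget * gadget -> gadget) :
    #|[set A : absorber | overlap (f A.1) A.2]|%:R <= 12 / N * cA :> K.
  rewrite (card_fibers (fun p g => overlap (f p) g)) natr_sum.
  apply: (@le_trans _ _ (\sum_(p : gadget * gadget) 12 / N * #|{: gadget}|%:R)).
    by apply: ler_sum => p _; apply: card_overlap.
  rewrite sumr_const -[leLHS]mulr_natr card_absorber.
  by rewrite (card_prod gadget gadget) natrM -!mulrA.
by have := c3 fst; have := c3 snd; rewrite -/X13 -/X23; lra.
Qed.

End Gadgets.

(** * Absorbing the leftover *)

Lemma matchable_sub (T C : finType) (E : C -> {set {set T}}) (C1 C2 : {set C})
    (R1 R2 : {set T}) :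
  C1 \subset C2 -> R2 \subset R1 -> matchable E C2 R2 -> matchable E C1 R1.
Proof.
move=> /subsetP C12 R21 [e [eE ed]]; exists e; split=> [c cC|c d cC dC].
  by have [? eR] := eE _ (C12 _ cC); rewrite (subset_trans eR).
by apply: ed; apply: C12.
Qed.

Section Absorb.
Variables (T C : finType) (E : C -> {set {set T}}).
Hypothesis E3 : forall c, uniform3 (E c).
Notation gadget := (C * T * T * T)%type.
Notation absorber := (gadget * gadget * gadget)%type.

Definition good (q : gadget) (A : absorber) : bool :=
  pregood E q A && ~~ selfoverlap A.

Lemma accepts_edges x (g : gadget) : accepts E x g ->
  [set x; g.1.2; g.2] \in E g.1.1.1 /\ gver g \in E g.1.1.1.
Proof. by rewrite /accepts in_setI !mem_link !in_setT => /andP[]. Qed.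

Lemma matchable3 (c1 c2 c3 : C) (f1 f2 f3 : {set T}) :
  [/\ c1 != c2, c1 != c3 & c2 != c3] ->
  [/\ [disjoint f1 & f2], [disjoint f1 & f3] & [disjoint f2 & f3]] ->
  f1 \in E c1 -> f2 \in E c2 -> f3 \in E c3 ->
  matchable E [set c1; c2; c3] (f1 :|: f2 :|: f3).
Proof.
move=> [c12 c13 c23] [d12 d13 d23] e1 e2 e3.
apply: matchableU; last exact: matchable1.
- by rewrite disjointUl !disjoints1 !inE c13 c23.
- by rewrite disjointUl d13 d23.
- by apply: matchableU; rewrite ?disjoints1 ?inE //; exact: matchable1.
Qed.

Lemma selfoverlapN (A : absorber) : ~~ selfoverlap A ->
  [/\ A.1.1.1.1.1 != A.1.2.1.1.1, A.1.1.1.1.1 != A.2.1.1.1 &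
      A.1.2.1.1.1 != A.2.1.1.1] /\
  [/\ [disjoint gver A.1.1 & gver A.1.2], [disjoint gver A.1.1 & gver A.2] &
      [disjoint gver A.1.2 & gver A.2]].
Proof.
rewrite /selfoverlap /overlap; case: (A.1.1.1.1.1 == _) => //=.
case: (A.1.1.1.1.1 == _); rewrite ?orbT //=.
case: (A.1.2.1.1.1 == _); rewrite ?orbT //=.
by rewrite !negb_or !negbK => /and3P[-> -> ->].
Qed.

(** An idle absorber uses its own three edges [{y_i, a_i, b_i}]. *)
Lemma good_matchable q A : good q A -> matchable E (acols A) (avers A).
Proof.
move=> /andP[/and4P[_ /accepts_edges[_ e1] /accepts_edges[_ e2] /accepts_edges[_ e3]]].
by move=> /selfoverlapN[cn dn]; apply: matchable3.
Qed.

(** The exchange: gadget [i] takes [{x_i, a_i, b_i}] instead, which frees [{y1, y2, y3}] for the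
    colour of [q]. *)
Lemma good_absorb q A : good q A -> q.1.1.1 \notin acols A ->
  [/\ q.1.1.2 != q.1.2, q.1.1.2 != q.2 & q.1.2 != q.2] ->
  [disjoint gver q & avers A] ->
  matchable E (q.1.1.1 |: acols A) (gver q :|: avers A).
Proof.
case: A q => [[[[[c1 y1] a1] b1] [[[c2 y2] a2] b2]] [[[c3 y3] a3] b3]].
move=> [[[c x1] x2] x3].
move=> /andP[/and4P[/= yE /accepts_edges[/= e1 f1] /accepts_edges[/= e2 f2]
  /accepts_edges[/= e3 f3]]].
move=> /selfoverlapN[/= cn dn] ccn xn dq.
have [ya1 yb1 ab1] := cards3_neq (E3 f1).
have [ya2 yb2 ab2] := cards3_neq (E3 f2).
have [ya3 yb3 ab3] := cards3_neq (E3 f3).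
rewrite /gpt /= in yE ya1 yb1 ab1 ya2 yb2 ab2 ya3 yb3 ab3.
move: dn; rewrite /gver /= !disjointUl !disjointUr !disjoints1 !inE => -[d12 d13 d23].
move: xn dq; rewrite /avers /gver /= !disjointUl !disjointUr !disjoints1 !inE.
move=> [x12 x13 x23] dq.
apply: (@matchable_sub _ _ _ _ ([set c] :|: [set c1; c2; c3]) _
  ([set y1; y2; y3] :|: ([set x1; a1; b1] :|: [set x2; a2; b2] :|: [set x3; a3; b3]))).
- by [].
- apply/subsetP => z; rewrite !inE => h.
  by repeat match goal with H : is_true (_ || _) |- _ => case/orP: H => H end;
    rewrite h ?orbT.
repeat match goal with
  | H : is_true (_ && _) |- _ => case/andP: H => ? ?
  | H : is_true (~~ (_ || _)) |- _ => rewrite negb_or in H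
  | H : is_true (~~ (_ == _)) |- _ => move/eqP in H
end.
have disj (S1 S2 : {set T}) : (forall z, z \in S1 -> z \in S2 -> False) ->
    [disjoint S1 & S2].
  by move=> h; apply/pred0P => z; apply/negP => /andP[/h].
apply: matchableU.
- by rewrite disjoints1.
- apply: disj => z; rewrite !inE /gpt /=.
  by do ![case/orP]; move=> /eqP ?; do ![case/orP]; move=> /eqP ?; congruence.
- exact: matchable1.
apply: matchable3 => //; split; apply: disj => z; rewrite !inE;
  by do ![case/orP]; move=> /eqP ?; do ![case/orP]; move=> /eqP ?; congruence.
Qed.

Lemma absorb_all (h : nat) (s : {set absorber}) (Cs : {set C}) (S : {set T}) :
  #|Cs| = h -> #|S| = (3 * h)%N ->
  {in s, forall A, exists q, good q A} ->
  {in s &, forall A B, A != B -> ~~ conflict A B} ->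
  {in s, forall A, [disjoint Cs & acols A] /\ [disjoint S & avers A]} ->
  (forall q, h <= #|s :&: [set A | good q A]|)%N ->
  matchable E (Cs :|: \bigcup_(A in s) acols A) (S :|: \bigcup_(A in s) avers A).
Proof.
elim: h s Cs S => [|h IH] s Cs S Ch Sh sg sc sd sq.
  rewrite (cards0_eq Ch) (cards0_eq Sh) !set0U; apply: matchable_bigcup.
    by move=> A B As Bs /(sc _ _ As Bs); rewrite negb_or !negbK => /andP[].
  by move=> A /sg[q]; apply: good_matchable.
have [c cC] : exists c, c \in Cs by apply/card_gt0P; rewrite Ch.
have /card_gt2P[x1 [x2 [x3 [[x1S x2S x3S] [x12 x23 x31]]]]] : (2 < #|S|)%N.
  by rewrite Sh; lia.
pose q : gadget := (c, x1, x2, x3).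
have [A] : exists A, A \in s :&: [set A | good q A].
  by apply/card_gt0P; apply: leq_trans (sq q).
rewrite !inE => /andP[As Aq].
have [dC dS] := sd _ As.
have qS : gver q \subset S.
  by apply/subsetP => z; rewrite !inE => /orP[/orP[]|] /eqP ->.
have absorbA : matchable E (c |: acols A) (gver q :|: avers A).
  apply: (good_absorb Aq) => /=.
  - by rewrite (disjointFr dC cC).
  - by rewrite x12 x23 eq_sym x31.
  - exact: disjointWl qS dS.
have rest : matchable E (Cs :\ c :|: \bigcup_(B in s :\ A) acols B)
    (S :\: gver q :|: \bigcup_(B in s :\ A) avers B).
  apply: IH.
  - by move: Ch; rewrite (cardsD1 c) cC => -[].
  - have q3 : #|gver q| = 3.
      by rewrite /gver /= setUC cardsU1 cards2 !inE negb_or x31 x12 eq_sym x23.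
    by rewrite cardsDS // Sh q3 mulnS addKn.
  - by move=> B; rewrite !inE => /andP[_ /sg].
  - by move=> B D; rewrite !inE => /andP[_ Bs] /andP[_ Ds]; apply: sc.
  - move=> B; rewrite !inE => /andP[_ /sd[dB dB']]; split.
      exact: disjointWl (subsetDl _ _) dB.
    exact: disjointWl (subsetDl _ _) dB'.
  move=> p; rewrite -ltnS; apply: leq_trans (sq p) _.
  rewrite (cardsD1 A) addnC; apply: (@leq_trans (#|(s :&: [set B | good p B]) :\ A| + 1)).
    by rewrite leq_add2l; case: (_ \in _).
  by rewrite addn1 ltnS subset_leq_card // setIDAC.
have nA B : B \in s :\ A -> [disjoint acols A & acols B] /\ [disjoint avers A & avers B].
  rewrite !inE => /andP[BA Bs]; have := sc _ _ As Bs; rewrite eq_sym => /(_ BA).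
  by rewrite negb_or !negbK => /andP[].
apply: matchable_sub (matchableU _ _ absorbA rest).
- have sub (X Y : {set C}) : Cs :|: (X :|: Y) \subset c |: X :|: (Cs :\ c :|: Y).
    apply/subsetP => d; rewrite !inE.
    by case: (d == c); case: (d \in Cs); case: (d \in X); case: (d \in Y).
  by rewrite (big_setD1 A As); apply: sub.
- have sub (W X Y : {set T}) : W \subset S ->
      W :|: X :|: (S :\: W :|: Y) \subset S :|: (X :|: Y).
    move=> /subsetP WS; apply/subsetP => z; rewrite !inE.
    by case: (z \in W) (WS z) => [/(_ isT) ->|_] //; case: (z \in S);
      case: (z \in X); case: (z \in Y).
  by rewrite (big_setD1 A As); apply: sub.
- rewrite (disjointUl [set c]) !(disjointUr (Cs :\ c)) -andbA disjoints1 !inE eqxx.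
  rewrite disjoints1 /=; apply/and3P; split.
  + apply/bigcupP => -[B]; rewrite 2!inE => /andP[_ Bs] cB.
    by have [/disjointFr/(_ cC)] := sd _ Bs; rewrite cB.
  + by rewrite disjoint_sym; apply: disjointWl (subsetDl _ _) dC.
  + by apply/bigcup_disjointP => B /nA[].
- rewrite (disjointUl (gver q)) !(disjointUr (S :\: gver q)).
  apply/andP; split; apply/andP; split.
  + by apply/pred0P => z /=; rewrite in_setD; case: (z \in gver q).
  + apply/bigcup_disjointP => B; rewrite 2!inE => /andP[_ /sd[_]].
    exact: disjointWl.
  + by rewrite disjoint_sym; apply: disjointWl (subsetDl _ _) dS.
  + by apply/bigcup_disjointP => B /nA[].
Qed.

End Absorb.

(** * Growth estimates *)

Lemma exists_natr_ge (K : archiRealFieldType) (x : K) : exists n : nat, x <= n%:R.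
Proof.
exists (Num.bound `|x|); apply: le_trans (ler_norm x) _.
by apply: ltW; apply: archi_boundP.
Qed.

Lemma eventually_pow4_le (B : nat) : (0 < B)%N ->
  exists n0 : nat, forall n, (n0 <= n)%N -> (n ^ 4 <= 2 ^ (n %/ B))%N.
Proof.
(* The factor 5 beats the exponent 4: with [j = n %/ D], [n ^ 4 <= D ^ 4 * j.+1 ^ 4 <= j.+1 ^ 5 <=
   (2 ^ j) ^ 5] as soon as [D ^ 4 <= j]. *)
move=> B0; pose D := (B * 5)%N.
have D0 : (0 < D)%N by rewrite muln_gt0 B0.
exists (D ^ 4 * D)%N => n nge; pose j := (n %/ D)%N.
have jge : (D ^ 4 <= j)%N by rewrite leq_divRL.
have nlt : (n <= D * j.+1)%N by rewrite mulnC ltnW // ltn_ceil.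
apply: (@leq_trans (D ^ 4 * j.+1 ^ 4)); first by rewrite -expnMn leq_exp2r.
apply: (@leq_trans (j.+1 ^ 5)).
  by rewrite (expnS _ 4) leq_mul // ltnW.
apply: (@leq_trans ((2 ^ j) ^ 5)); first by rewrite leq_exp2r // ltn_expl.
by rewrite -expnM leq_exp2l // /j /D divnMA leq_trunc_div.
Qed.

(** The cube of [expR (a * n / 3) >= a * n / 3] grows faster than the square of [n]. *)
Lemma eventually_sqr_le_expR (K : realType) (a : K) : 0 < a ->
  exists n0 : nat, forall n, (n0 <= n)%N -> n%:R ^+ 2 <= expR (a * n%:R).
Proof.
move=> a0; have [n0 n0P] := exists_natr_ge (27 / a ^+ 3).
exists n0 => n nn0.
have a30 : 0 < a ^+ 3 by rewrite exprn_gt0.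
have : 27 <= n%:R * a ^+ 3.
  by rewrite -ler_pdivrMr //; apply: le_trans n0P _; rewrite ler_nat.
have n0' : 0 <= n%:R :> K by [].
set x : K := n%:R in n0' * => xa.
have -> : a * x = 3%:R * (a * x / 3) by field.
rewrite expRM_natl; apply: (@le_trans _ _ ((a * x / 3) ^+ 3)); last first.
  rewrite lerXn2r ?nnegrE ?expR_ge0 //.
    by rewrite !mulr_ge0 ?invr_ge0 // ltW.
  by apply: le_trans (expR_ge1Dx _); rewrite lerDr.
have -> : (a * x / 3) ^+ 3 = x ^+ 2 * (x * a ^+ 3 / 27) by field.
by rewrite ler_peMr ?sqr_ge0 // ler_pdivlMr // mul1r.
Qed.

(** With [p * x >= 3], the power is at most [expR (- 3)], and [expR 3 >= 1 + 3]. *)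
Lemma exists_expr_le_quarter (K : realType) (x : K) : 0 < x -> x <= 1 ->
  exists2 p : nat, (0 < p)%N & (1 - x) ^+ p <= 1 / 4.
Proof.
move=> x0 x1; have [p pP] := exists_natr_ge (3 / x).
have px : 3 <= p%:R * x by rewrite -ler_pdivrMr.
exists p.
  rewrite lt0n; apply/negP => /eqP p0; move: px; rewrite p0 mul0r.
  by rewrite lern0.
have : (1 - x) ^+ p <= expR (- x) ^+ p.
  by rewrite lerXn2r ?nnegrE ?expR_ge0 ?subr_ge0 ?expR_ge1Dx.
move=> /le_trans; apply.
rewrite -expRM_natl mulrN expRN div1r lef_pV2 ?posrE ?expR_gt0 //.
by apply: le_trans (expR_ge1Dx _); lra.
Qed.

(** * Combining absorption with the almost perfect matching *)

Lemma card_bigcup_disjoint (I A : finType) (s : {set I}) (F : I -> {set A}) (k : nat) :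
  {in s, forall i, #|F i| = k} ->
  {in s &, forall i j, i != j -> [disjoint F i & F j]} ->
  #|\bigcup_(i in s) F i| = (k * #|s|)%N.
Proof.
move: {2}#|s| (erefl #|s|) => m; elim: m s => [|m IH] s sm Fk dis.
  by rewrite (cards0_eq sm) big_set0 !cards0 muln0.
have [i is_] : exists i, i \in s by apply/card_gt0P; rewrite sm.
have si : #|s :\ i| = m by move: sm; rewrite (cardsD1 i) is_ => -[].
rewrite (big_setD1 i is_) /=; have := leq_card_setU (F i) (\bigcup_(j in s :\ i) F j).
have -> : [disjoint F i & \bigcup_(j in s :\ i) F j].
  apply/bigcup_disjointP => j; rewrite !inE => /andP[ji js].
  by apply: dis => //; rewrite eq_sym.
case=> _ /eqP ->; rewrite Fk // IH //.
- by rewrite si sm mulnS.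
- by move=> j; rewrite inE => /andP[_ /Fk].
- by move=> j l; rewrite !inE => /andP[_ js] /andP[_ ls]; apply: dis.
Qed.

Lemma card_link_setC (T : finType) (E : {set {set T}}) (U : {set T}) (v : T) :
  (#|link E setT v| <= #|link E (~: U) v| + 2 * (#|U| * #|T|))%N.
Proof.
have sub : link E setT v \subset
    link E (~: U) v :|: setX U [set: T] :|: setX [set: T] U.
  apply/subsetP => -[a b]; rewrite mem_link => /and3P[_ _ abE].
  rewrite !in_setU mem_link !in_setX !in_setC !in_setT abE !andbT /=.
  by case: (a \in U); case: (b \in U).
apply: leq_trans (subset_leq_card sub) _.
apply: leq_trans (leq_card_setU3 _ _ _) _.
by rewrite !cardsX !cardsT -addnA leq_add2l mul2n -addnn leq_add2l mulnC.
Qed.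

Section Main.
Variables (K : realType) (T C : finType) (E : C -> {set {set T}}) (delta : K).
Hypothesis E3 : forall c, uniform3 (E c).
Hypothesis TC : #|T| = (3 * #|C|)%N.
Hypothesis delta0 : 0 < delta.
Hypothesis delta1 : delta <= 1 / 3.
Notation D c v := (#|link (E c) setT v|%:R).
Notation N := (#|T|%:R).
Hypothesis ore : forall c u v w, [set u; v; w] \in E c ->
  (4 / 3 + 2 * delta) * N ^+ 2 <= D c u + D c v.
Hypothesis mindeg : forall c v, (1 / 3 + 2 * delta) * N ^+ 2 <= D c v.
Hypothesis C0 : (0 < #|C|)%N.
Notation absorber := ((C * T * T * T) * (C * T * T * T) * (C * T * T * T))%type.

Let T0 : (0 < #|T|)%N. Proof. by rewrite TC muln_gt0. Qed.
Let N0 : 0 < N :> K. Proof. by rewrite ltr0n. Qed.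

Lemma card_acols q A : good E q A -> #|acols A| = 3.
Proof.
move=> /andP[_ /selfoverlapN[[c12 c13 c23] _]].
by rewrite /acols setUC cardsU1 cards2 !inE negb_or c12 eq_sym c13 eq_sym c23.
Qed.

Lemma card_avers q A : good E q A -> #|avers A| = 9.
Proof.
move=> /andP[/and4P[_ /accepts_edges[_ /E3 e1] /accepts_edges[_ /E3 e2]
  /accepts_edges[_ /E3 e3]] /selfoverlapN[_ [d12 d13 d23]]].
rewrite /avers; have [_] := leq_card_setU (gver A.1.1 :|: gver A.1.2) (gver A.2).
rewrite (disjointUl (gver A.1.1)) d13 d23 => /eqP ->.
have [_] := leq_card_setU (gver A.1.1) (gver A.1.2); rewrite d12 => /eqP ->.
by rewrite e1 e2 e3.
Qed.

(** Let [k = #|T| %/ (L * p)]. After the selection, the total weight of the at most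
    [#|T| ^ 4 <= 2 ^ k] quadruples is at most [2 ^ k * (1 / 4) ^ k]. A single quadruple has weight
    [(1 / 2) ^ hits], so it is hit at least [k] times. *)
Lemma absorbing_family (L p : nat) :
  (0 < L)%N -> (0 < p)%N ->
  216 * 2592 / delta ^+ 4 <= L%:R ->
  (1 - delta ^+ 4 / 2592 / 4) ^+ p <= 1 / 4 ->
  36 * 2592 / delta ^+ 4 <= N ->
  (#|T| ^ 4 <= 2 ^ (#|T| %/ (L * p)))%N ->
  exists s : {set absorber}, [/\ #|s| = (#|T| %/ L)%N,
    {in s, forall A, exists q, good E q A},
    {in s &, forall A B, A != B -> ~~ conflict A B} &
    forall q, (#|T| %/ (L * p) <= #|s :&: [set A | good E q A]|)%N].
Proof.
move=> L0 p0 LP pP NP pow.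
(* Half of the density in [card_pregood]; the other half pays for the self-overlapping absorbers, a
   fraction at most [36 / N]. *)
set ga := delta ^+ 4 / 2592 in pP.
have d40 : 0 < delta ^+ 4 by rewrite exprn_gt0.
have ga0 : 0 < ga by rewrite divr_gt0.
have ga1 : ga <= 1.
  rewrite ler_pdivrMr // mul1r; apply: (@le_trans _ _ 1); last by lra.
  by rewrite exprn_ile1 ?(ltW delta0) //; move: delta1; lra.
have NL : 36 / N <= ga.
  move: NP; rewrite ler_pdivrMr // ler_pdivrMr // => h.
  by rewrite /ga; lra.
have LG : 216 / L%:R <= ga.
  move: LP; rewrite ler_pdivrMr // ler_pdivrMr ?ltr0n // => h.
  by rewrite /ga; lra.
have A0 : (0 < #|{: absorber}|)%N by rewrite !card_prod !muln_gt0 T0 C0.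
have goodq (q : C * T * T * T) :
    ga * #|{: absorber}|%:R <= #|[set A | good E q A]|%:R.
  have := card_pregood TC delta0 ore mindeg C0 q.
  have := card_selfoverlap TC C0 K.
  have : (#|[set A | pregood E q A]| <=
      #|[set A | good E q A]| + #|[set A : absorber | selfoverlap A]|)%N.
    apply: leq_trans (leq_card_setU _ _); apply: subset_leq_card.
    apply/subsetP => A; rewrite in_setU ![A \in [set _ | _]]in_set /good => ->.
    by rewrite /= orNb.
  rewrite -(ler_nat K) natrD => h1 h2 h3.
  have : 36 / N * #|{: absorber}|%:R <= ga * #|{: absorber}|%:R by rewrite ler_wpM2r.
  have e : delta ^+ 4 / 1296 = 2 * ga by rewrite /ga; field.
  by move: h3; rewrite e; lra.
have Q0 : (0 < #|{: (C * T * T * T)%type}|)%N by rewrite !card_prod !muln_gt0 T0 C0.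
have confl A := card_conflict TC C0 K A.
have small : 2 * (#|T| %/ L)%:R * (108 / N) <= ga.
  apply: le_trans LG; rewrite ler_pdivlMr ?ltr0n // -!mulrA.
  rewrite (_ : 2 * _ = 216 * ((#|T| %/ L)%:R * L%:R / N)); last by ring.
  by rewrite ler_piMr // ler_pdivrMr // mul1r -natrM ler_nat leq_trunc_div.
have [s [sk sg sc sw]] := select_absorbers A0 Q0 ga0 (@conflictxx T C)
  (@conflictC T C) goodq confl small.
exists s; split=> //.
  by move=> A /sg[q]; rewrite inE => Aq; exists q.
move=> q; set k := (#|T| %/ (L * p))%N; set t := #|_|.
have le1 : (1 / 2) ^+ t <=
    #|{: (C * T * T * T)%type}|%:R * (1 - ga / 4) ^+ (#|T| %/ L) :> K.
  apply: le_trans sw; rewrite (bigD1 q) //= lerDl; apply: sumr_ge0 => i _.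
  by rewrite exprn_ge0 ?divr_ge0.
have g0 : 0 <= 1 - ga / 4.
  by rewrite subr_ge0 ler_pdivrMr // mul1r (le_trans ga1) // ler1n.
have g1 : 1 - ga / 4 <= 1 by rewrite gerBl divr_ge0 // ltW.
have le2 : (1 - ga / 4) ^+ (#|T| %/ L) <= (1 / 4) ^+ k.
  apply: (@le_trans _ _ ((1 - ga / 4) ^+ (p * k))).
    by rewrite ler_wiXn2l // /k divnMA mulnC leq_trunc_div.
  by rewrite exprM lerXn2r ?nnegrE ?exprn_ge0 ?divr_ge0.
have le3 : #|{: (C * T * T * T)%type}|%:R <= 2 ^+ k :> K.
  rewrite -natrX ler_nat; apply: leq_trans pow; rewrite !card_prod !expnSr expn0 mul1n.
  by rewrite !leq_mul // TC leq_pmull.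
have : (1 / 2) ^+ t <= (1 / 2) ^+ k :> K.
  apply: le_trans le1 _; apply: (@le_trans _ _ (2 ^+ k * (1 / 4) ^+ k)).
    by apply: ler_pM; rewrite ?exprn_ge0.
  by rewrite -exprMn (_ : 2 * (1 / 4) = 1 / 2) //; field.
rewrite !div1r !exprVn lef_pV2 ?posrE ?exprn_gt0 // -!natrX ler_nat.
by rewrite leq_exp2l.
Qed.

(** The absorbers are set aside, [nibble] runs on the remaining colours and vertices, and its
    leftover of at most [h] colours goes to [absorb_all]. *)
Lemma matchable_setT_of_family (s : {set absorber}) (h : nat) (lam rho : K) :
  {in s, forall A, exists q, good E q A} ->
  {in s &, forall A B, A != B -> ~~ conflict A B} ->
  (forall q, h <= #|s :&: [set A | good E q A]|)%N ->
  36 * #|s|%:R <= delta * N ->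
  (0 < h)%N -> 0 < lam -> 24 * lam <= (3 * h)%:R ->
  36 * lam + 288 * lam ^+ 2 <= rho * (3 * h)%:R ^+ 2 ->
  N ^+ 2 * (1 + rho) ^+ #|T| <= expR (lam * (delta / 4)) ->
  matchable E setT setT.
Proof.
move=> sg sc sq sN h0 lam0 lamh rhoh final.
have sd A B : A \in s -> B \in s -> A != B ->
    [disjoint acols A & acols B] /\ [disjoint avers A & avers B].
  by move=> As Bs /(sc _ _ As Bs); rewrite negb_or !negbK => /andP[].
pose CU := \bigcup_(A in s) acols A; pose U := \bigcup_(A in s) avers A.
have cCU : #|CU| = (3 * #|s|)%N.
  apply: card_bigcup_disjoint; first by move=> A /sg[q]; apply: card_acols.
  by move=> A B As Bs /(sd _ _ As Bs)[].
have cU : #|U| = (9 * #|s|)%N.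
  apply: card_bigcup_disjoint; first by move=> A /sg[q]; apply: card_avers.
  by move=> A B As Bs /(sd _ _ As Bs)[].
pose S0 := ~: U.
have cS0 : #|S0| = (3 * #|~: CU|)%N.
  by apply: (@addnI #|U|); rewrite cardsC TC -(cardsC CU) mulnDr cCU cU mulnA.
have U2 : (2 * #|U| <= #|T|)%N.
  rewrite cU -(ler_nat K) !natrM; move: sN delta1 N0.
  have : delta * N <= 1 / 3 * N by rewrite ler_wpM2r.
  lra.
have S0gt : (0 < #|S0|)%N.
  have := cardsC U; rewrite -/S0; case: #|S0| => //; rewrite addn0 => UT.
  by move: U2; rewrite UT mul2n -addnn -[leqRHS]addn0 leq_add2l leqNgt T0.
(* Deleting [U] destroys at most [2 * #|U| * N = 18 * #|s| * N] pairs of a link, which is at most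
   [delta / 2 * N ^+ 2]. *)
pose x0 c v : K := D c v / N ^+ 2 - delta / 2.
have N20 : 0 < N ^+ 2 :> K by rewrite exprn_gt0.
have dens S c v : S = S0 -> x0 c v <= linkdens K E S c v.
  move=> ->; rewrite /linkdens.
  have S0N : #|S0|%:R <= N :> K by rewrite ler_nat max_card.
  apply: (@le_trans _ _ (#|link (E c) S0 v|%:R / N ^+ 2)); last first.
    rewrite ler_wpM2l // lef_pV2 ?posrE ?exprn_gt0 ?ltr0n //.
    by rewrite ler_sqr ?nnegrE.
  rewrite /x0 lerBlDr -[delta / 2](@mulfK _ (N ^+ 2)) ?gt_eqF // -mulrDl.
  rewrite ler_pM2r ?invr_gt0 //.
  have := card_link_setC (E c) U v; rewrite -/S0 -(ler_nat K) natrD !natrM cU natrM.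
  move=> /le_trans; apply; rewrite lerD2l.
  have := ler_wpM2r (ltW N0) sN; rewrite expr2; lra.
have [|||C1 [S1 [CC SS Ch S1C mat]]] :=
    @nibble K T C E E3 x0 lam lam0 (delta / 4) rho h (~: CU) S0 _ _ h0 lamh rhoh cS0.
- move=> c v; rewrite /x0; have : 1 / 3 + 2 * delta <= D c v / N ^+ 2.
    by rewrite ler_pdivlMr.
  by move: delta0; lra.
- move=> c u v w /ore le; rewrite /x0.
  have : 4 / 3 + 2 * delta <= D c u / N ^+ 2 + D c v / N ^+ 2.
    by rewrite -mulrDl ler_pdivlMr.
  by move: delta0; lra.
- have rho0 : 0 <= rho.
    have h2 : 0 < (3 * h)%:R ^+ 2 :> K by rewrite exprn_gt0 // ltr0n muln_gt0.
    rewrite -(pmulr_lge0 _ h2); apply: le_trans rhoh.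
    by rewrite addr_ge0 ?mulr_ge0 ?sqr_ge0 ?(ltW lam0).
  apply: le_trans final; apply: ler_pM.
  + by apply: sumr_ge0 => p _; apply: expR_ge0.
  + by rewrite exprn_ge0 // addr_ge0.
  (* Initially no density is below its target, so every term of the potential is at most 1. *)
  + apply: (@le_trans _ _ (\sum_(p : C * T) 1)).
      apply: ler_sum => p _; rewrite -expR0 ler_expR pmulr_rle0 // subr_le0.
      exact: dens.
    rewrite sumr_const -[leLHS]mulr_natr mul1r card_prod natrM expr2 ler_wpM2r //.
    by rewrite ler_nat TC leq_pmull.
  + by rewrite ler_weXn2l ?lerDl // (leq_trans (max_card _)) // TC leq_pmull.
have absorbed : matchable E (C1 :|: CU) (S1 :|: U).
  apply: (absorb_all E3 (erefl #|C1|) S1C sg sc).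
    move=> A As; split; rewrite disjoint_sym.
      apply: (@disjointW _ _ CU _ (~: CU)); rewrite ?bigcup_sup //.
      by rewrite -setI_eq0 setICr.
    apply: (@disjointW _ _ U _ (~: U)); rewrite ?bigcup_sup //.
    by rewrite -setI_eq0 setICr.
  by move=> q; apply: leq_trans (sq q).
apply: matchable_sub (matchableU _ _ absorbed mat) => //.
- apply/subsetP => c _; rewrite in_setU in_setU in_setD in_setC.
  by case: (c \in C1); case: (c \in CU).
- apply/pred0P => c; rewrite /= in_setU in_setD in_setC.
  by case: (c \in C1); case: (c \in CU).
- apply/pred0P => c; rewrite /= in_setU in_setD in_setC.
  by case: (c \in S1); case: (c \in U).
Qed.

End Main.

Lemma natr_divn_ge (K : realFieldType) (n B : nat) : (0 < B)%N -> (2 * B <= n)%N ->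
  n%:R <= 2 * B%:R * (n %/ B)%:R :> K.
Proof.
move=> B0 Bn; rewrite -!natrM ler_nat.
have : (n < (n %/ B).+1 * B)%N by apply: ltn_ceil.
have : (2 <= n %/ B)%N by rewrite leq_divRL.
by nia.
Qed.

Lemma eventually_matchable (K : realType) (delta : K) :
  0 < delta -> delta <= 1 / 3 ->
  exists n0 : nat, forall (T C : finType) (E : C -> {set {set T}}),
    (n0 <= #|T|)%N -> (forall c, uniform3 (E c)) -> #|T| = (3 * #|C|)%N ->
    (forall c u v w, [set u; v; w] \in E c ->
      (4 / 3 + 2 * delta) * #|T|%:R ^+ 2 <=
        #|link (E c) setT u|%:R + #|link (E c) setT v|%:R) ->
    (forall c v, (1 / 3 + 2 * delta) * #|T|%:R ^+ 2 <= #|link (E c) setT v|%:R) ->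
    matchable E setT setT.
Proof.
move=> d0 d1.
have d40 : 0 < delta ^+ 4 by rewrite exprn_gt0.
have d41 : delta ^+ 4 <= 1 by rewrite exprn_ile1 ?(ltW d0) //; lra.
have [||p p0 pP] := @exists_expr_le_quarter K (delta ^+ 4 / 2592 / 4).
- by rewrite !divr_gt0.
- by rewrite !ler_pdivrMr // (le_trans d41) // mul1r mulr_ege1 ?ler1n.
have [L LP] := exists_natr_ge (216 * 2592 / delta ^+ 4 + 36 / delta).
have a0 : 0 < 216 * 2592 / delta ^+ 4 by rewrite divr_gt0 ?mulr_gt0 ?ltr0n.
have b0 : 0 < 36 / delta by rewrite divr_gt0 ?ltr0n.
have L0 : (0 < L)%N.
  by rewrite -(ltr_nat K); apply: lt_le_trans LP; rewrite addr_gt0.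
have LP1 : 216 * 2592 / delta ^+ 4 <= L%:R by apply: le_trans LP; rewrite lerDl ltW.
have LP2 : 36 / delta <= L%:R by apply: le_trans LP; rewrite lerDr ltW.
pose B := (L * p)%N; have B0 : (0 < B)%N by rewrite muln_gt0 L0.
have B1 : 1 <= B%:R :> K by rewrite ler1n.
(* [lam] will be [ka * n]. The constant 1152 is [8 * 144], chosen so that [rho] below equals
   [ka * delta / 8]. *)
pose ka := delta / (1152 * B%:R ^+ 2).
have kaB : 1152 * ka * B%:R ^+ 2 = delta.
  by rewrite /ka; field; rewrite gt_eqF // ltr0n.
have ka0 : 0 < ka by rewrite divr_gt0 // mulr_gt0 // exprn_gt0 // ltr0n.
have [n1 n1P] := eventually_pow4_le B0.
have kd0 : 0 < ka * delta / 8 by rewrite divr_gt0 // mulr_gt0.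
have [n2 n2P] := eventually_sqr_le_expR kd0.
have [n3 n3P] := exists_natr_ge (36 * 2592 / delta ^+ 4).
have [n4 n4P] := exists_natr_ge (1 / ka).
exists (maxn (maxn n1 n2) (maxn (maxn n3 n4) (2 * B)))%N => T C E.
rewrite !geq_max => /andP[/andP[Tn1 Tn2] /andP[/andP[Tn3 Tn4] TnB]] E3 TC ore mindeg.
have T0 : (0 < #|T|)%N by apply: leq_trans TnB; rewrite muln_gt0.
have C0 : (0 < #|C|)%N by move: T0; rewrite TC muln_gt0.
have [||s [sk sg sc sq]] := absorbing_family TC d0 d1 ore mindeg C0 L0 p0 LP1 pP.
- by apply: le_trans n3P _; rewrite ler_nat.
- exact: n1P.
clear LP LP1 pP n3P a0.
have hN := natr_divn_ge K B0 TnB.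
set h := (#|T| %/ B)%N in hN; pose n : K := #|T|%:R.
have n0 : 0 < n by rewrite ltr0n.
have kn : 1 <= ka * n.
  by rewrite mulrC -ler_pdivrMr //; apply: le_trans n4P _; rewrite ler_nat.
(* For [lam >= 1] the error is at most [324 * lam ^+ 2], and [n <= 2 * B * h] turns this into
   [rho * (3 * h) ^+ 2]. *)
pose rho := 144 * ka ^+ 2 * B%:R ^+ 2.
have rhoE : rho = ka * delta / 8 by rewrite /rho -kaB; field.
have h0 : 0 <= h%:R :> K by [].
rewrite -/n in hN.
apply: (@matchable_setT_of_family K T C E delta E3 TC d0 d1 ore mindeg C0 s h
  (ka * n) rho sg sc).
- exact: sq.
- rewrite sk -/n; apply: (@le_trans _ _ (delta * L%:R * (#|T| %/ L)%:R)).
    rewrite ler_wpM2r //; move: LP2; rewrite ler_pdivrMr //; lra.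
  by rewrite -mulrA ler_wpM2l ?(ltW d0) // -natrM ler_nat mulnC leq_trunc_div.
- by rewrite divn_gt0 //; apply: leq_trans TnB; rewrite leq_pmull.
- by rewrite mulr_gt0.
- rewrite natrM.
  have : 16 * ka * B%:R <= 1.
    have : 1152 * ka * B%:R <= delta.
      rewrite -[leRHS]kaB; apply: ler_wpM2l; last by rewrite expr2 ler_peMl.
      by rewrite mulr_ge0 ?ler0n ?(ltW ka0).
    lra.
  move=> kB; have := ler_wpM2l (ltW ka0) hN; have := ler_wpM2r h0 kB; lra.
- rewrite natrM.
  have nn : n ^+ 2 <= (2 * B%:R * h%:R) ^+ 2.
    by rewrite lerXn2r ?nnegrE ?mulr_ge0 ?(ltW n0).
  have := ler_wpM2l (ltW (exprn_gt0 2 ka0)) nn.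
  have : ka * n <= (ka * n) ^+ 2 by rewrite expr2 ler_peMl // (le_trans _ kn).
  rewrite /rho !exprMn; lra.
have rho0 : 0 <= rho by rewrite rhoE divr_ge0 // mulr_ge0 // ltW.
(* Half of the exponent pays for [n ^+ 2], the other half for
   [(1 + rho) ^+ #|T| <= expR (n * rho)]. *)
rewrite -/n (_ : ka * n * (delta / 4) = ka * delta / 8 * n + n * rho); last first.
  by rewrite rhoE; field.
rewrite expRD; apply: ler_pM; rewrite ?sqr_ge0 ?exprn_ge0 ?addr_ge0 //.
  exact: n2P.
by rewrite /n expRM_natl lerXn2r ?nnegrE ?expR_ge0 ?addr_ge0 ?expR_ge1Dx.
Qed.

(** * From degree sums to links *)

Lemma sigma2_le (T : finType) (F : hypergraph3 T) (u v : T) :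
  Defs.adjacent F u v -> (sigma2 F <= deg F u + deg F v)%N.
Proof.
by move=> uv; exact: (@bigmin_le_cond _ nat _ _ (u, v) (fun p => Defs.adjacent F p.1 p.2)
  (fun p => (deg F p.1 + deg F p.2)%N)).
Qed.

(** Removing [v] from an edge through it leaves two vertices, hence two ordered pairs. *)
Lemma deg_link (T : finType) (F : hypergraph3 T) (v : T) :
  (2 * deg F v <= #|link (edges F) setT v|)%N.
Proof.
pose S := [set e in edges F | v \in e].
pose X e := [set p : T * T | [set v; p.1; p.2] == e].
have X2 e : e \in S -> (2 <= #|X e|)%N.
  rewrite inE => /andP[eF ve]; have e3 := edges_uniform eF.
  have : #|e :\ v| == 2 by move: e3; rewrite (cardsD1 v) ve add1n => -[->].
  case/cards2P => a [b [ab eab]].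
  have eE : e = [set v; a; b] by rewrite -(setD1K ve) eab setUA.
  apply: (@leq_trans #|[set (a, b); (b, a)]|).
    by rewrite cards2 xpair_eqE (negPf ab).
  apply: subset_leq_card; apply/subsetP => p.
  by rewrite !inE => /orP[] /eqP -> /=; rewrite eE // set3CA.
have -> : #|link (edges F) setT v| = (\sum_(e in S) #|X e|)%N.
  rewrite -sum1_card (partition_big (fun p : T * T => [set v; p.1; p.2]) (mem S)) /=.
    apply: eq_bigr => e; rewrite inE => /andP[eF ve]; rewrite -sum1_card.
    apply: eq_bigl => -[a b]; rewrite mem_link !in_setT inE /=.
    by case: eqP => [->|]; rewrite ?eF ?andbF.
  by move=> [a b]; rewrite mem_link !inE eqxx !andbT.
rewrite mulnC /deg -/S -sum_nat_const; exact: leq_sum.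
Qed.

Lemma adjacent_link (T : finType) (F : hypergraph3 T) (u v w : T) :
  [set u; v; w] \in edges F -> Defs.adjacent F u v.
Proof.
move=> uvw; have [uv _ _] := cards3_neq (edges_uniform uvw).
rewrite /Defs.adjacent uv; apply/existsP; exists [set u; v; w].
by rewrite uvw !inE !eqxx orbT.
Qed.

Lemma exists_edge (T : finType) (F : hypergraph3 T) (v : T) :
  ~~ isolated F v -> exists u w, [set v; u; w] \in edges F.
Proof.
rewrite /isolated -lt0n => degv.
have : (0 < #|link (edges F) setT v|)%N.
  by apply: leq_trans (deg_link F v); rewrite muln_gt0.
by case/card_gt0P => -[u w]; rewrite mem_link => /and3P[_ _ ?]; exists u, w.
Qed.

Theorem theorem3 (R : realType) (delta : R) (delta_gt0 : 0 < delta) :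
  exists n0 : nat, forall n : nat, (n0 <= n)%N -> (3 %| n)%N ->
  forall (T : finType) (F : 'I_(n %/ 3)%N -> hypergraph3 T),
    #|T| = n ->
    (forall i v, ~~ isolated (F i) v) ->
    (forall i, (sigma2 (F i))%:R > (2 / 3 + delta) * n%:R ^+ 2) ->
    exists e : 'I_(n %/ 3)%N -> {set T}, rainbow_matching F e.
Proof.
(* [eventually_matchable] asks for a density gain of at most [1 / 3]; lowering [delta] only weakens
   the degree condition. *)
pose d := Num.min delta (1 / 3).
have d0 : 0 < d by rewrite lt_min delta_gt0 divr_gt0.
have d1 : d <= 1 / 3 by rewrite ge_min lexx orbT.
have dd : d <= delta by rewrite ge_min lexx.
have [n0 n0P] := eventually_matchable d0 d1.
exists n0 => n n0n n3 T F Tn noniso sig.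
have ore c u v w : [set u; v; w] \in edges (F c) ->
    (4 / 3 + 2 * d) * #|T|%:R ^+ 2 <=
      #|link (edges (F c)) setT u|%:R + #|link (edges (F c)) setT v|%:R.
  move=> uvw; have := sigma2_le (adjacent_link uvw); have := sig c.
  have := deg_link (F c) u; have := deg_link (F c) v.
  rewrite -!(ler_nat R) !natrM natrD Tn.
  have : d * n%:R ^+ 2 <= delta * n%:R ^+ 2 by rewrite ler_wpM2r ?sqr_ge0.
  lra.
(* Every vertex has a neighbour, whose link contains at most [#|T| ^ 2] pairs; the degree sum leaves
   the rest to [v]. *)
have mindeg c v : (1 / 3 + 2 * d) * #|T|%:R ^+ 2 <= #|link (edges (F c)) setT v|%:R.
  have [u [w vuw]] := exists_edge (noniso c v).
  have := ore _ _ _ _ vuw.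
  have : #|link (edges (F c)) setT u|%:R <= #|T|%:R ^+ 2 :> R.
    by rewrite -natrX ler_nat -cardsT card_link_le.
  lra.
have [] := n0P T 'I_(n %/ 3) (fun i => edges (F i)) _ _ _ ore mindeg.
- by rewrite Tn.
- by move=> c e; apply: edges_uniform.
- by rewrite card_ord mulnC divnK.
move=> e [eF edis]; exists e; split=> [i|i j ij].
  by have [] := eF i (in_setT i).
exact: edis (in_setT i) (in_setT j) ij.
Qed.
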